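(* Let $R$ be the set of all $(a,b)\in\mathbb{R}^2$ such that $0<b<1$, $1-b<a<1+b$, and for every integer $k\ge 0$ the point $L_{a,b}^{2k-1}(Z)$ belongs to the left half-plane $\{(x,y): x\le 0\}$ and the point $L_{a,b}^{2k}(Z)$ belongs to the right half-plane $\{(x,y): x\ge 0\}$, where $L_{a,b}$ is the Lozi map and $Z=Z_{a,b}$ is the point $$Z=\left(\frac{2+a+\sqrt{a^2+4b}}{2(1+a-b)},\,0\right).$$ Then for every $(a,b)\in R$, the topological entropy of $L_{a,b}$ is zero: $h_{top}(L_{a,b})=0$.
   Context: For real parameters $a,b$ with $b\ne 0$, the Lozi map is the piecewise affine homeomorphism $L_{a,b}:\mathbb{R}^2\to\mathbb{R}^2$, $L_{a,b}(x,y)=(1+y-a|x|,\,bx)$; $L_{a,b}^n$ for $n\in\mathbb{Z}$ denotes its iterates (with $L_{a,b}^{-1}$ the inverse map). For $0<b<1$ and $1-b<a<1+b$ the map has a saddle fixed point $X=\left(\frac{1}{1+a-b},\frac{b}{1+a-b}\right)$ in the first quadrant, and $Z$ is the first point at which the half of the unstable manifold of $X$ that starts at $X$ and goes to the right meets the $x$-axis. (The point $L_{a,b}^{-1}(Z)$ lies on the $y$-axis, and half-planes are understood as closed.) Since $\mathbb{R}^2$ is not compact, $h_{top}(L_{a,b})$ is understood as the topological entropy of the homeomorphism of the one-point compactification $\mathbb{R}^2\cup\{\infty\}$ that extends $L_{a,b}$ and fixes $\infty$. *)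

(* Defs.v *)
From HB Require Import structures.
From mathcomp Require Import all_boot all_order all_algebra finmap.
From mathcomp Require Import all_classical all_reals all_analysis.
From mathcomp Require Import ring.

Set Implicit Arguments.
Unset Strict Implicit.
Unset Printing Implicit Defensive.

Import Order.TTheory GRing.Theory Num.Theory.
Import numFieldNormedType.Exports.

Local Open Scope classical_set_scope.
Local Open Scope ring_scope.

(* Topological entropy in the sense of Adler, Konheim and McAndrew. *)
Section TopologicalEntropy.
Variables (R : realType) (T : topologicalType).
Implicit Types (f : T -> T) (U : set (set T)).

Definition open_cover U : Prop :=
  U `<=` open /\ \bigcup_(A in U) A = [set: T].

Definition finite_subcover U (V : {fset set T}) : Prop :=
  [set` V] `<=` U /\ \bigcup_(A in [set` V]) A = [set: T].

(* The infimum is a minimum as soon as U has a finite subcover, which is always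
   the case for an open cover of a compact space. *)
Definition cover_number U : \bar R :=
  ereal_inf [set (#|` V|%:R)%:E | V in finite_subcover U].

Definition cover_entropy U : \bar R := lne (cover_number U).

(* U \/ f^-1 U \/ ... \/ f^-(n-1) U *)
Definition iter_join f U (n : nat) : set (set T) :=
  [set \bigcap_(i < n) (iter i f @^-1` A i) |
     A in [set A : nat -> set T | forall i, (i < n)%N -> U (A i)]].

(* By subadditivity the upper limit is a limit when T is compact, f is
   continuous and U is an open cover. *)
Definition entropy_wrt f U : \bar R :=
  limn_esup (fun n => ((n%:R)^-1)%:E * cover_entropy (iter_join f U n))%E.

Definition topological_entropy f : \bar R :=
  ereal_sup [set entropy_wrt f U | U in open_cover].

End TopologicalEntropy.
Arguments topological_entropy R {T} f.

Definition compactify_map (X : Type) (f : X -> X) :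
    one_point_compactification X -> one_point_compactification X :=
  fun p => if p is Some x then Some (f x) else None.

Section Lozi.
Variable R : realType.
Implicit Types (a b : R) (p : R * R).

Definition lozi a b p : R * R := (1 + p.2 - a * `|p.1|, b * p.1).

Definition lozi_inv a b p : R * R := (p.2 / b, p.1 - 1 + a * `|p.2 / b|).

Lemma loziK a b : b != 0 -> cancel (lozi a b) (lozi_inv a b).
Proof.
move=> b0 [x y]; rewrite /lozi /lozi_inv /= [b * x]mulrC mulfK //.
by congr (_, _); ring.
Qed.

Lemma lozi_invK a b : b != 0 -> cancel (lozi_inv a b) (lozi a b).
Proof.
move=> b0 [x y]; rewrite /lozi /lozi_inv /= [b * _]mulrC divfK //.
by congr (_, _); ring.
Qed.

Definition lozi_iter a b (n : int) : R * R -> R * R :=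
  match n with
  | Posz m => iter m (lozi a b)
  | Negz m => iter m.+1 (lozi_inv a b)
  end.

Definition loziZ a b : R * R :=
  ((2 + a + Num.sqrt (a ^+ 2 + 4 * b)) / (2 * (1 + a - b)), 0).

Definition left_half_plane : set (R * R) := [set p | p.1 <= 0].
Definition right_half_plane : set (R * R) := [set p | 0 <= p.1].

Definition lozi_region : set (R * R) := [set ab |
  let: (a, b) := ab in
  [/\ 0 < b < 1, 1 - b < a < 1 + b &
      forall k : nat,
        left_half_plane (lozi_iter a b (2 * k%:Z - 1) (loziZ a b)) /\
        right_half_plane (lozi_iter a b (2 * k%:Z) (loziZ a b))]].

(* Entropy on the one-point compactification of the plane, whose extra point
   is fixed by the extended map. *)
Definition lozi_entropy a b : \bar R :=
  topological_entropy R (compactify_map (lozi a b)).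

End Lozi.

(* Main.v *)
(* Let k = (a + sqrt (a^2 + 4 b)) / 2 and l = k - a, so that a = k - l, b = k l
   and 0 < l < 1 < k. Call a point transient if it has a neighbourhood to which
   no orbit returns after a bounded time. If every point outside a finite
   invariant set is transient, the entropy is zero, since orbits then have only
   polynomially many itineraries. The finite set here consists of infinity, the
   fixed points X and Y, and the attracting 2-cycle {P, Q}.
   Write R and L for the visits of an orbit to the right and left half-planes.
   The linear forms mu (vanishing on the unstable line of X) and ga (vanishing
   on the stable line of Y) are monotone along all orbits, so that a nontransient
   point satisfies mu <= 0 and ga >= 0, as does its whole full orbit. The
   hypothesis on Z and convexity show that an orbit with mu <= 0 that leaves the
   right half-plane after RR alternates forever, hence tends to {P, Q}; and that
   LLR can only be followed by RR or by an alternating orbit. Thus the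
   itinerary of a nontransient point is constant or alternating in both
   directions of time, and boundedness forces it to be X, Y, P or Q. *)
Require Import Defs.
From mathcomp Require Import all_boot all_order all_algebra finmap.
From mathcomp Require Import all_classical all_reals all_analysis.
From mathcomp Require Import ring lra.

Set Implicit Arguments.
Unset Strict Implicit.
Unset Printing Implicit Defensive.

Import Order.TTheory GRing.Theory Num.Theory.
Import numFieldNormedType.Exports.


(** * Counting itineraries *)

(** Listing the elements of such a set and padding with [None] presents it as the image of a partial
    function on [k] positions. *)
Lemma card_small_sets (I : finType) (k : nat) (S : {set {set I}}) :
  (forall s, s \in S -> (#|s| <= k)%N) -> (#|S| <= #|I|.+1 ^ k)%N.
Proof.
move=> Sk.
pose img (g : {ffun 'I_k -> option I}) := [set x | Some x \in codom g].
have /subset_leq_card : S \subset [set img g | g : {ffun 'I_k -> option I}].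
  apply/fintype.subsetP => s /Sk sk; apply/imsetP.
  exists [ffun i : 'I_k => onth (enum s) i] => //.
  apply/setP => x; rewrite inE; apply/idP/codomP => [xs|[i]].
    have xe : x \in enum s by rewrite mem_enum.
    have lt : (index x (enum s) < k)%N.
      by rewrite (leq_trans _ sk)// cardE index_mem.
    exists (Ordinal lt); rewrite ffunE /= onthE.
    by rewrite (nth_map x) ?index_mem// nth_index.
  rewrite ffunE /= onthE => /esym sx.
  have lt : (i < size (enum s))%N.
    rewrite ltnNge; apply/negP => le; move: sx.
    by rewrite nth_default ?size_map.
  by move: sx; rewrite (nth_map x)// => -[<-]; rewrite -mem_enum mem_nth.
move=> /leq_trans; apply; apply: leq_trans (leq_imset_card _ _) _.
by rewrite card_ffun card_option card_ord.
Qed.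

(* A word is recovered from its letters at the positions that are initial,
   marked, or preceded by a marked letter: the others are forced. *)
Lemma card_words (I : finType) (marked : pred I) (n k : nat)
    (A : {set {ffun 'I_n -> I}}) :
  (forall w, w \in A -> (#|[set i | marked (w i)]| <= k)%N) ->
  (forall w w' (i j : 'I_n), w \in A -> w' \in A -> i.+1 = j -> w i = w' i ->
    ~~ marked (w i) -> ~~ marked (w j) -> ~~ marked (w' j) -> w j = w' j) ->
  (#|A| <= (n * #|I|).+1 ^ (k + k).+1)%N.
Proof.
move=> Ak Astep.
pose M (w : {ffun 'I_n -> I}) := [set i | marked (w i)].
pose N (w : {ffun 'I_n -> I}) := [set j : 'I_n | [exists i in M w, i.+1 == j]].
pose O := [set j : 'I_n | j == 0 :> nat].
pose D w := O :|: (M w :|: N w).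
(* The graph of [w] over [D w] has at most [k + k + 1] pairs, so [card_small_sets] bounds the number
   of these codes. *)
pose enc (w : {ffun 'I_n -> I}) := [set (i, w i) | i in D w].
have O1 : (#|O| <= 1)%N.
  apply/card_le1P => i; rewrite inE => /eqP i0 j; rewrite !inE.
  by rewrite -val_eqE /= i0.
have cN w : (#|N w| <= #|M w|)%N.
  pose prev (j : 'I_n) : 'I_n := Ordinal (leq_ltn_trans (leq_pred j) (ltn_ord j)).
  have pinj : {in N w &, injective prev}.
    move=> i j; rewrite !inE => /exists_inP[i' _ /eqP ii] /exists_inP[j' _ /eqP jj].
    move=> /(congr1 val) /=; rewrite -ii -jj /= => e.
    by apply: val_inj; rewrite /= -ii -jj e.
  rewrite -(card_in_imset pinj).
  apply/subset_leq_card/fintype.subsetP => _ /imsetP[j + ->].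
  rewrite inE => /exists_inP[i iM /eqP ij]; suff -> : prev j = i by [].
  by apply: val_inj; rewrite /= -ij.
have cD w : w \in A -> (#|D w| <= (k + k).+1)%N.
  move=> /Ak wk; rewrite -add1n (leq_trans (finset.leq_card_setU _ _))// leq_add//.
  by rewrite (leq_trans (finset.leq_card_setU _ _))// leq_add// (leq_trans (cN w)).
have encP w i c : ((i, c) \in enc w) = (i \in D w) && (c == w i).
  apply/imsetP/andP => [[j jD [-> ->]]|[iD /eqP ->]]; first by [].
  by exists i.
have enc_inj : {in A &, injective enc}.
  move=> w w' wA wA' ee; apply/ffunP.
  suff H (m : nat) (i : 'I_n) : i = m :> nat -> w i = w' i by move=> i; exact: H.
  elim: m i => [|m IH] j jm.
    have : (j, w j) \in enc w by rewrite encP eqxx !inE jm.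
    by rewrite ee encP => /andP[_ /eqP].
  have [jD|jD] := boolP (j \in D w).
    have : (j, w j) \in enc w by rewrite encP eqxx jD.
    by rewrite ee encP => /andP[_ /eqP].
  have [jD'|jD'] := boolP (j \in D w').
    have : (j, w' j) \in enc w' by rewrite encP eqxx jD'.
    by rewrite -ee encP => /andP[_ /eqP].
  have mn : (m < n)%N by rewrite (ltn_trans _ (ltn_ord j))// jm.
  have ij : (Ordinal mn).+1 = j by rewrite jm.
  move: jD jD'; rewrite !inE !negb_or => /andP[_ /andP[mj nj]] /andP[_ /andP[mj' _]].
  apply: (Astep w w' (Ordinal mn)) => //; first exact: IH.
  apply: contra nj => mi; apply/exists_inP; exists (Ordinal mn); rewrite ?inE//.
  exact/eqP.
rewrite -(card_in_imset enc_inj).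
have -> : (n * #|I|)%N = #|[the finType of ('I_n * I)%type]|.
  by rewrite card_prod card_ord.
apply: card_small_sets => _ /imsetP[w wA ->].
exact: leq_trans (leq_imset_card _ _) (cD _ wA).
Qed.

Local Open Scope classical_set_scope.
Local Open Scope ring_scope.

(** * Entropy when all but finitely many points are transient *)

Definition transient (T : topologicalType) (f : T -> T) (z : T) : Prop :=
  exists2 W, nbhs z W &
    exists N, forall y n, (N <= n)%N -> W y -> ~ W (iter n f y).

Lemma disjoint_nbhs (T : topologicalType) (P : {fset T}) :
  hausdorff_space T ->
  exists2 D : T -> set T, (forall p, p \in P -> nbhs p (D p)) &
    forall p q x, p \in P -> q \in P -> D p x -> D q x -> p = q.
Proof.
rewrite open_hausdorff => hT.
have /choice[A HA] (pq : T * T) : exists A : set T * set T, pq.1 != pq.2 ->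
    [/\ nbhs pq.1 A.1, nbhs pq.2 A.2 & A.1 `&` A.2 = set0].
  case: pq => p q; have [->|/= pq] := eqVneq p q; first by exists (set0, set0).
  have [[A B] /= [pA qB] [oA oB /eqP AB]] := hT _ _ pq; exists (A, B) => _.
  by split=> //; apply: open_nbhs_nbhs; split=> //; exact: set_mem.
(* The pairs chosen for [(p, q)] and [(q, p)] need not be swaps of each other, so both are used. *)
pose E p q := if p == q then setT else (A (p, q)).1 `&` (A (q, p)).2.
exists (fun p => \bigcap_(q in [set` P]) E p q) => [p pP|p q x pP qP Dp Dq].
  apply: filter_bigI => q _; rewrite /E; case: eqVneq => [_|pq].
    exact: filterT.
  have [/= ? _ _] := HA (p, q) pq; rewrite eq_sym in pq.
  by have [/= _ ? _] := HA (q, p) pq; apply: filterI.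
apply/eqP/negPn/negP => pq; have [/= _ _ dis] := HA (p, q) pq.
have := Dp q qP; have := Dq p pP; rewrite /E eq_sym (negbTE pq) => -[_ ?] [? _].
by suff : set0 x by []; rewrite -dis.
Qed.

(** Counted from the first visit, every visit occurs after fewer than [N] further steps. *)
Lemma card_transient_visits (T : topologicalType) (f : T -> T) (W : set T)
    (N : nat) (x : T) (n : nat) (S : {set 'I_n}) :
  (forall y k, (N <= k)%N -> W y -> ~ W (iter k f y)) ->
  (forall i, i \in S -> W (iter i f x)) -> (#|S| <= N)%N.
Proof.
move=> WN WS; have [->|/set0Pn[i0 i0S]] := eqVneq S finset.set0.
  by rewrite cards0.
case: (arg_minnP (fun i : 'I_n => i : nat) i0S) => m mS mmin.
have lt i : i \in S -> (i - m < N)%N.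
  move=> iS; rewrite ltnNge; apply/negP => le.
  apply: (WN _ _ le (WS _ mS)); rewrite -iterD subnK ?mmin//.
  exact: WS.
have [N0|N0] := posnP N; first by move: (lt _ mS); rewrite N0.
case: N N0 lt {WN} => // N _ lt.
rewrite -[N.+1]card_ord.
have inj : {in S &, injective (fun i : 'I_n => inord (i - m) : 'I_N.+1)}.
  move=> i j iS jS /(congr1 val) /=; rewrite !inordK ?lt// => e.
  by apply: val_inj; rewrite /= -(subnK (mmin _ iS)) -(subnK (mmin _ jS)) e.
by rewrite -(card_in_imset inj) max_card.
Qed.

(** Each point gets a neighbourhood inside a member of [U]: off [P], one that orbits visit boundedly
    often; on [P], one so small that the next letter is forced as long as the letters stay in [P]. A
    finite subcover labels the orbits, and [card_words] counts the words. *)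
Lemma iter_join_polynomial (T : ptopologicalType) (f : T -> T) (P : {fset T})
    (U : set (set T)) :
  compact [set: T] -> hausdorff_space T -> continuous f ->
  (forall p, p \in P -> f p \in P) ->
  (forall x, x \notin P -> transient f x) -> open_cover U ->
  exists C K, forall n, exists2 V : {fset set T},
    finite_subcover (iter_join f U n) V & (#|` V| <= (n * C).+1 ^ K)%N.
Proof.
move=> cT hT cf fP trP [oU covU].
have /choice[Ux HUx] (x : T) : exists A, U A /\ A x.
  have : [set: T] x by [].
  by rewrite -covU => -[A UA Ax]; exists A.
have [D nD disD] := disjoint_nbhs P hT.
have /choice[WN HWN] (x : T) : exists WN : set T * nat, x \notin P ->
    nbhs x WN.1 /\ forall y n, (WN.2 <= n)%N -> WN.1 y -> ~ WN.1 (iter n f y).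
  have [xP|/trP[W nW [N HN]]] := boolP (x \in P); first by exists (set0, 0%N).
  by exists (W, N).
pose B x := Ux x `&`
  (if x \in P then D x `&` (f @^-1` D (f x)) else (WN x).1).
have nB x : nbhs x (B x).
  have [Ux1 Ux2] := HUx x; apply: filterI.
    by apply: open_nbhs_nbhs; split => //; exact: oU.
  case: ifPn => [xP|/HWN[]//]; apply: filterI; first exact: nD.
  by apply: cf; apply: nD; exact: fP.
move: (cT); rewrite compact_cover.
move=> /(_ T setT (fun x => (B x)^°)) [x _||F _ covF].
- exact: open_interior.
- by move=> x _; exists x => //; exact: nB.
have /choice[lab Hlab] (y : T) : exists d : F, B (val d) y.
  have [//|d dF /interior_subset dy] := covF y.
  by exists [` dF]%fset.
exists #|{: F}|, (\sum_(d : F) (WN (val d)).2 + \sum_(d : F) (WN (val d)).2).+1 => n.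
pose A : {set {ffun 'I_n -> F}} :=
  [set w : {ffun 'I_n -> F} | `[< exists x, forall i, w i = lab (iter i f x) >]]%SET.
(* The default [setT] concerns only positions beyond the word, which the intersection excludes. *)
pose cyl (w : {ffun 'I_n -> F}) : set T :=
  \bigcap_(i < n) (iter i f @^-1`
    (if insub i is Some j then Ux (val (w j)) else setT)).
exists [fset V in [seq cyl w | w <- enum A]]%fset.
  split.
    move=> V /=; rewrite !inE => /mapP[w _ ->].
    case: n @A @cyl w => [|n] A cyl w.
      exists (fun=> setT) => //=.
      by apply: eq_bigcapr => i.
    exists (fun i => Ux (val (w (inord i)))) => /=.
      by move=> i _; have [] := HUx (val (w (inord i))).
    apply: eq_bigcapr => i ilt; case: insubP => [j _ ji|]; last by rewrite ilt.
    by congr (_ @^-1` Ux (val (w _))); apply: val_inj; rewrite /= inordK.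
  rewrite -subTset => x _.
  pose w := [ffun i : 'I_n => lab (iter i f x)].
  exists (cyl w); rewrite /= ?inE.
    apply/mapP; exists w => //; rewrite mem_enum inE; apply/asboolP; exists x => i.
    by rewrite ffunE.
  move=> i /= ilt; case: insubP => [j _ ji|//]; rewrite ffunE ji.
  by have [] := Hlab (iter i f x).
rewrite card_fseq (leq_trans (size_undup _))// size_map -cardE.
apply: (@card_words _ (fun d => val d \notin P)).
  move=> w; rewrite inE => /asboolP[x wx].
  have -> : [set i | val (w i) \notin P]%SET =
      \bigcup_(d : F | val d \notin P) [set i | w i == d]%SET.
    apply/setP => i; rewrite inE; apply/idP/bigcupP => [wP|[d dP]].
      by exists (w i); rewrite ?inE.
    by rewrite inE => /eqP ->.
  apply: leq_trans (_ : (\sum_(d : F | val d \notin P) (WN (val d)).2 <= _)%N).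
    elim/big_ind2 : _ => [|S1 m1 S2 m2 h1 h2|d dP]; first by rewrite cards0.
      by rewrite (leq_trans (finset.leq_card_setU _ _))// leq_add.
    apply: (card_transient_visits (HWN _ dP).2 (x := x)) => i.
    rewrite inE => /eqP wi; have := Hlab (iter i f x); rewrite -wx wi.
    by rewrite /B (negbTE dP) => -[].
  by rewrite big_mkcond leq_sum// => d _; case: ifP.
move=> w w' i j; rewrite !inE => -[x wx] [x' wx'] ij ww'.
move=> /negPn wiP /negPn wjP /negPn wjP'.
(* The next point lies both in [D] of its own letter and in [D] of the image of the previous letter,
   and these sets are disjoint for distinct points of [P]. *)
have step (v : {ffun 'I_n -> F}) y :
    (forall i : 'I_n, v i = lab (iter i f y)) -> val (v i) \in P ->
    val (v j) \in P -> val (v j) = f (val (v i)).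
  move=> vy vi vj.
  have := Hlab (iter j f y); rewrite -vy /B vj => -[_ [Dj _]].
  have := Hlab (iter i f y); rewrite -vy /B vi => -[_ [_]] /=; rewrite -iterS ij.
  by move=> Di; apply: disD Dj Di => //; exact: fP.
have wiP' : val (w' i) \in P by rewrite -ww'.
by apply: val_inj; rewrite (step w x)// (step w' x')// ww'.
Qed.

(** The bound [ln n.+1 <= 2 * sqrt n.+1], obtained from [ln x <= x] at [x = sqrt n.+1], reduces the
    limit to that of [harmonic]. *)
Lemma ln_polynomial_cvg (R : realType) (C K : nat) :
  (fun n => n.+1%:R^-1 * ln ((n.+1 * C).+1 ^ K)%N%:R : R) @ \oo --> (0 : R).
Proof.
pose B n : R := K%:R * (C%:R * harmonic n + 2 * Num.sqrt (harmonic n)).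
have B0 : B @ \oo --> (0 : R).
  have -> : (0 : R) = K%:R * (C%:R * 0 + 2 * Num.sqrt 0).
    by rewrite sqrtr0 !mulr0 addr0 mulr0.
  apply: cvgMr; apply: cvgD; apply: cvgMr; first exact: cvg_harmonic.
  by apply: (cvg_comp _ _ cvg_harmonic); exact: sqrt_continuous.
apply: (squeeze_cvgr _ (cvg_cst 0) B0); apply: nearW => n.
have ln1p m : (0 : R) <= ln m.+1%:R by rewrite ln_ge0// ler1n.
rewrite natrX lnXn ?ltr0n// -[ln _ *+ K]mulr_natl.
rewrite mulr_ge0 ?mulr_ge0 ?invr_ge0//= mulrCA ler_wpM2l//.
have le1 : ln (n.+1 * C).+1%:R <= ln C.+1%:R + ln n.+1%:R :> R.
  rewrite -lnM ?posrE ?ltr0n// -natrM ler_ln ?posrE ?ltr0n// ler_nat.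
  by rewrite [ltnRHS]mulSn mulnC; exact: (leq_add (ltn0Sn n) (leqnn _)).
have le2 : ln C.+1%:R <= C%:R :> R.
  by rewrite -natr1 addrC le_ln1Dx// (lt_le_trans (ltrN10 _))// ler0n.
have le3 : ln n.+1%:R <= 2 * Num.sqrt n.+1%:R :> R.
  have s0 : 0 < Num.sqrt n.+1%:R :> R by rewrite sqrtr_gt0 ltr0n.
  have {1}-> : n.+1%:R = Num.sqrt n.+1%:R ^+ 2 :> R by rewrite sqr_sqrtr.
  by rewrite lnXn// -[ln _ *+ 2]mulr_natl ler_pM2l ?ltr0n// ltW// ln_sublinear.
have -> : Num.sqrt (harmonic n) = n.+1%:R^-1 * Num.sqrt n.+1%:R :> R.
  rewrite /harmonic /= sqrtrV ?ler0n//.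
  have s0 : 0 < Num.sqrt n.+1%:R :> R by rewrite sqrtr_gt0 ltr0n.
  have {2}-> : n.+1%:R = Num.sqrt n.+1%:R ^+ 2 :> R by rewrite sqr_sqrtr.
  by field; rewrite gt_eqF.
rewrite /harmonic /= [C%:R * _]mulrC mulrCA -mulrDr ler_wpM2l ?invr_ge0//.
by rewrite (le_trans le1)// lerD.
Qed.

Lemma cover_number_ge1 (R : realType) (T : ptopologicalType)
  (U : set (set T)) : (1 <= cover_number R U)%E.
Proof.
apply: le_ereal_inf_tmp => _ [V [_ cV] <-]; rewrite lee_fin ler1n.
have : [set: T] point by [].
by rewrite -cV => -[A AV _]; rewrite cardfs_gt0; apply/fset0Pn; exists A.
Qed.

(* An orbit leaves a neighbourhood of the finite invariant set P boundedly
   often, and is determined by its itinerary otherwise: the number of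
   itineraries of length n is polynomial in n. *)
Lemma topological_entropy_eq0 (R : realType) (T : ptopologicalType)
    (f : T -> T) (P : {fset T}) :
  compact [set: T] -> hausdorff_space T -> continuous f ->
  (forall p, p \in P -> f p \in P) ->
  (forall x, x \notin P -> transient f x) ->
  topological_entropy R f = 0%E.
Proof.
move=> cT hT cf fP trP.
have ent0 (U : set (set T)) : open_cover U -> entropy_wrt R f U = 0%E.
  move=> oU; have [C [K HV]] := iter_join_polynomial cT hT cf fP trP oU.
  suff H : (fun n => ((n%:R)^-1)%:E * cover_entropy R (iter_join f U n))%E
      @ \oo --> (0%E : \bar R).
    rewrite /entropy_wrt is_cvg_limn_esupE; first exact/cvg_lim.
    by apply/cvg_ex; exists 0%E.
  (* The shift drops the term of index 0, with its division by zero. *)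
  rewrite -cvg_shiftS.
  pose B n : \bar R := (n.+1%:R^-1 * ln ((n.+1 * C).+1 ^ K)%N%:R)%:E.
  have cB : B n @[n --> \oo] --> (0%E : \bar R).
    by apply: cvg_EFin; [exact: nearW|exact: ln_polynomial_cvg].
  apply: (squeeze_cvge _ (cvg_cst 0%E) cB).
  apply: nearW => n; rewrite mule_ge0 ?lee_fin ?invr_ge0//; last first.
    by rewrite lne_ge0 cover_number_ge1.
  rewrite /B EFinM lee_wpmul2l ?lee_fin ?invr_ge0//.
  have [V fV cV] := HV n.+1.
  rewrite -lne_EFin ?ltr0n ?expn_gt0// lee_lne ?in_itv/= ?leey ?andbT.
  - by apply: ge_ereal_inf; exists (#|` V|%:R)%:E; [exists V|rewrite lee_fin ler_nat].
  - by rewrite (le_trans _ (cover_number_ge1 _ _)).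
  - by rewrite lee_fin ler0n.
rewrite /topological_entropy (_ : [set _ | _ in _] = [set 0%E]) ?ereal_sup1//.
apply/seteqP; split => [_ [U oU <-]|_ ->]; first exact: ent0.
(* The trivial cover shows that the supremum is not taken over the empty set. *)
exists [set setT]; last first.
  by apply: ent0; split=> [_ ->|]; [exact: openT|rewrite bigcup_set1].
by split=> [_ ->|]; [exact: openT|rewrite bigcup_set1].
Qed.

(** * Maps of a one-point compactification *)

Section OnePointCompactification.
Variable X : topologicalType.
Implicit Types (f g : X -> X).

(** Continuity at infinity amounts to properness: the preimage of a compact set under [f] is its
    image under [g]. *)
Lemma compactify_map_continuous f g :
  continuous f -> continuous g -> cancel f g -> cancel g f ->
  continuous (compactify_map f).
Proof.
move=> cf cg fK gK [x|] A; rewrite /nbhs /=.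
  by move=> nA; exact: (cf x _ nA).
case=> C [cC clC] CA; exists (f @^-1` C).
  split; last by apply: preimage_closed clC => ? _; exact: cf.
  rewrite (_ : _ @^-1` _ = g @` C); last first.
    by apply/seteqP; split=> [x Cx|_ [y Cy <-]] /=; [exists (f x)|rewrite gK].
  by apply: continuous_compact => //; exact: continuous_subspaceT.
move=> [x|] [[y Cy [yx]]|] //=; last by move=> _; apply: CA; right.
by apply: CA; left; exists (f x) => //; rewrite -yx.
Qed.

Lemma transient_compactify_map f x :
  transient f x -> transient (compactify_map f) (Some x).
Proof.
move=> [W nW [N HN]]; exists (Some @` W).
  exact: one_point_compactification_some_nbhs.
have it n y : iter n (compactify_map f) (Some y) = Some (iter n f y).
  by elim: n => //= n ->.
exists N => _ n Nn [y Wy <-]; rewrite it => -[z Wz [zy]].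
by apply: (HN y n Nn Wy); rewrite -zy.
Qed.

End OnePointCompactification.

Lemma plane_locally_compact (R : realType) : locally_compact [set: R * R].
Proof.
move=> z _; rewrite withinET; exists (closed_ball z.1 1 `*` closed_ball z.2 1).
  exists (closed_ball z.1 1, closed_ball z.2 1) => //=.
  by split; apply/nbhs_closedballP; exists 1%:pos.
have cK : compact (closed_ball z.1 (1 : R) `*` closed_ball z.2 (1 : R)).
  by apply: compact_setX; exact: closed_ballR_compact.
by split=> //; apply: compact_closed cK; exact: norm_hausdorff.
Qed.

(** * Criteria for transience *)

Section Transience.
Variables (T : topologicalType) (f g : T -> T).
Hypotheses (cf : continuous f) (cg : continuous g).

Lemma transient_image z : transient f (f z) -> transient f z.
Proof.
move=> [W nW [N HN]]; exists (f @^-1` W); first exact: cf.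
by exists N => y n Nn Wy; rewrite /preimage /= -iterS iterSr; exact: HN.
Qed.

Lemma transient_iter n z : transient f (iter n f z) -> transient f z.
Proof. by elim: n => // n IH; rewrite iterS => /transient_image. Qed.

Lemma transient_preimage z : cancel f g -> cancel g f ->
  transient f (g z) -> transient f z.
Proof.
move=> fK gK [W nW [N HN]]; exists (g @^-1` W); first exact: cg.
exists N => y n Nn Wy; rewrite /preimage /=.
suff -> : g (iter n f y) = iter n f (g y) by exact: HN.
by elim: n {Nn} => //= n <-; rewrite fK gK.
Qed.

(** A level [c] strictly between [V (f z)] and [V z] is crossed downwards in one step by all orbits
    starting near [z], and they never climb back above it. *)
Lemma transient_lyapunov (R : realType) (V : T -> R) z :
  continuous V -> (forall y, V (f y) <= V y) -> V (f z) < V z ->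
  transient f z.
Proof.
move=> cV fV fz; pose c := (V (f z) + V z) / 2.
exists [set y | c < V y /\ V (f y) < c].
  have cVf : V (f y) @[y --> z] --> V (f z).
    by apply: (cvg_comp _ _ (cf (x := z))); exact: cV.
  near=> y; split; near: y.
    by apply: (cvgr_gt _ (cV z)); rewrite /c midf_lt//.
  by apply: (cvgr_lt _ cVf); rewrite /c midf_lt.
exists 1%N => y [//|n] _ [_ yc] [+ _]; apply/negP; rewrite -leNgt ltW//.
apply: le_lt_trans yc; elim: n => [//|n IH].
by rewrite iterS (le_trans (fV _)).
Unshelve. all: by end_near. Qed.

End Transience.

Lemma geometric_eq0 (R : realType) (r B x : R) :
  0 <= r < 1 -> (forall n, `|x| <= r ^+ n * B) -> x = 0.
Proof.
move=> /andP[r0 r1] H; apply/normr0_eq0/le_anti; rewrite normr_ge0 andbT.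
have : (fun n => r ^+ n * B) @ \oo --> (0 : R).
  by rewrite -(mul0r B); apply: cvgMl; apply: cvg_expr; rewrite ger0_norm.
by move=> rB; apply: (cvgr_to_ge rB); exact: nearW.
Qed.

Section PlaneContinuity.
Variable R : realType.

Lemma fst_continuous : continuous (fun z : R * R => z.1).
Proof. by case=> x y; exact: cvg_fst. Qed.

Lemma snd_continuous : continuous (fun z : R * R => z.2).
Proof. by case=> x y; exact: cvg_snd. Qed.

Lemma pair_continuous (f g : R * R -> R) :
  continuous f -> continuous g -> continuous (fun z => (f z, g z)).
Proof. by move=> cf cg z; exact: (cvg_pair (cf z) (cg z)). Qed.

Lemma lozi_continuous (a b : R) : continuous (lozi a b).
Proof.
apply: pair_continuous => z.
  apply: cvgB; first by apply: cvgD; [exact: cvg_cst|exact: snd_continuous].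
  by apply: cvgMr; apply: cvg_norm; exact: fst_continuous.
by apply: cvgMr; exact: fst_continuous.
Qed.

Lemma lozi_inv_continuous (a b : R) : continuous (lozi_inv a b).
Proof.
apply: pair_continuous => z; first by apply: cvgMl; exact: snd_continuous.
apply: cvgD; first by apply: cvgB; [exact: fst_continuous|exact: cvg_cst].
by apply: cvgMr; apply: cvg_norm; apply: cvgMl; exact: snd_continuous.
Qed.

End PlaneContinuity.

(** * The attracting 2-cycle *)

Section PeriodTwoOrbit.
Variables (R : realType) (a b : R).
Hypotheses (a0 : 0 < a) (b0 : 0 < b) (b1 : b < 1).
Hypotheses (ab1 : 1 - b < a) (ab2 : a < 1 + b).

Local Notation L := (lozi a b).
Local Ltac plra := move: a0 b0 b1 ab1 ab2; lra.
Local Ltac pnra := move: a0 b0 b1 ab1 ab2; nra.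

(** [ptU] and [ptV] are the abscissas of the 2-cycle: they solve [V = 1 + b V - a U] and
    [U = 1 + b U + a V]. *)
Definition ptU : R := (1 - b + a) / ((1 - b) ^+ 2 + a ^+ 2).
Definition ptV : R := (1 - b - a) / ((1 - b) ^+ 2 + a ^+ 2).
Definition ptP : R * R := (ptU, b * ptV).
Definition ptQ : R * R := (ptV, b * ptU).

Let D0 : 0 < (1 - b) ^+ 2 + a ^+ 2.
Proof. by rewrite ltr_wpDl ?sqr_ge0// exprn_gt0. Qed.

Lemma ptU_gt0 : 0 < ptU. Proof. by rewrite divr_gt0//; plra. Qed.

Lemma ptV_lt0 : ptV < 0.
Proof. by rewrite ltr_pdivrMr// mul0r; plra. Qed.

Lemma L_ptP : L ptP = ptQ.
Proof.
rewrite /lozi /= ger0_norm ?(ltW ptU_gt0)//; congr (_, _).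
by rewrite /ptU /ptV; field; rewrite gt_eqF.
Qed.

Lemma L_ptQ : L ptQ = ptP.
Proof.
rewrite /lozi /= ler0_norm ?(ltW ptV_lt0)//; congr (_, _).
by rewrite /ptU /ptV; field; rewrite gt_eqF.
Qed.

Lemma iter_L_ptP n : iter n.*2 L ptP = ptP.
Proof. by elim: n => //= n ->; rewrite L_ptP L_ptQ. Qed.

(* Up to the sign of each term, the deviations of x_n from the 2-cycle satisfy
   d_{n+1} = a d_n - b d_{n-1}, for which
   (1 + b) (d_n^2 + d_{n-1}^2) - 2 a d_n d_{n-1} is nonincreasing. *)
Definition quad (s x y : R) : R :=
  (1 + b) * ((b * x) ^+ 2 + y ^+ 2) - s * (2 * a * b * x * y).
Definition qP (z : R * R) : R := quad 1 (z.1 - ptU) (z.2 - b * ptV).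
Definition qQ (z : R * R) : R := quad (-1) (z.1 - ptV) (z.2 - b * ptU).

Lemma L_devP z : 0 <= z.1 ->
  (L z).1 - ptV = (z.2 - b * ptV) - a * (z.1 - ptU) /\
  (L z).2 - b * ptU = b * (z.1 - ptU).
Proof.
move=> z0; have := congr1 fst L_ptP.
rewrite /lozi /= (ger0_norm z0) ger0_norm ?(ltW ptU_gt0)// => E.
by split; [rewrite -{1}E|]; ring.
Qed.

Lemma L_devQ z : z.1 <= 0 ->
  (L z).1 - ptU = (z.2 - b * ptU) + a * (z.1 - ptV) /\
  (L z).2 - b * ptV = b * (z.1 - ptV).
Proof.
move=> z0; have := congr1 fst L_ptQ.
rewrite /lozi /= (ler0_norm z0) ler0_norm ?(ltW ptV_lt0)// => E.
by split; [rewrite -{1}E|]; ring.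
Qed.

Lemma qQ_L z : 0 <= z.1 -> qQ (L z) = qP z -
  (1 - b) * (a * b * (z.1 - ptU) - (1 + b) * (z.2 - b * ptV)) ^+ 2.
Proof. by move=> /L_devP[E1 E2]; rewrite /qQ E1 E2 /qP /quad; ring. Qed.

Lemma qP_L z : z.1 <= 0 -> qP (L z) = qQ z -
  (1 - b) * (a * b * (z.1 - ptV) + (1 + b) * (z.2 - b * ptU)) ^+ 2.
Proof. by move=> /L_devQ[E1 E2]; rewrite /qP E1 E2 /qQ /quad; ring. Qed.

Lemma qQ_L_le z : 0 <= z.1 -> qQ (L z) <= qP z.
Proof. by move=> z0; rewrite qQ_L// gerBl mulr_ge0 ?sqr_ge0//; plra. Qed.

Lemma qP_L_le z : z.1 <= 0 -> qP (L z) <= qQ z.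
Proof. by move=> z0; rewrite qP_L// gerBl mulr_ge0 ?sqr_ge0//; plra. Qed.

(** In the variables [b x] and [y] the form has eigenvalues [1 + b - a] and [1 + b + a]. *)
Lemma quad_ge s x y : s = 1 \/ s = -1 ->
  (1 + b - a) * ((b * x) ^+ 2 + y ^+ 2) <= quad s x y.
Proof.
move=> [->|->]; rewrite -subr_ge0.
  have -> : quad 1 x y - (1 + b - a) * ((b * x) ^+ 2 + y ^+ 2) =
      a * (b * x - y) ^+ 2 by rewrite /quad; ring.
  by rewrite mulr_ge0 ?sqr_ge0 ?ltW.
have -> : quad (-1) x y - (1 + b - a) * ((b * x) ^+ 2 + y ^+ 2) =
    a * (b * x + y) ^+ 2 by rewrite /quad; ring.
by rewrite mulr_ge0 ?sqr_ge0 ?ltW.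
Qed.

Lemma quad_le s x y : s = 1 \/ s = -1 ->
  quad s x y <= (1 + b + a) * ((b * x) ^+ 2 + y ^+ 2).
Proof.
move=> [->|->]; rewrite -subr_ge0.
  have -> : (1 + b + a) * ((b * x) ^+ 2 + y ^+ 2) - quad 1 x y =
      a * (b * x + y) ^+ 2 by rewrite /quad; ring.
  by rewrite mulr_ge0 ?sqr_ge0 ?ltW.
have -> : (1 + b + a) * ((b * x) ^+ 2 + y ^+ 2) - quad (-1) x y =
    a * (b * x - y) ^+ 2 by rewrite /quad; ring.
by rewrite mulr_ge0 ?sqr_ge0 ?ltW.
Qed.

Lemma qQ_bounded (B : R) : exists C, forall z,
  `|z.1| <= B -> `|z.2| <= B -> qQ z <= C.
Proof.
exists ((1 + b + a) * ((b * (B + `|ptV|)) ^+ 2 + (B + `|b * ptU|) ^+ 2)) => z h1 h2.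
apply: le_trans (quad_le _ _ _) _; first by right.
have sq (s t : R) : `|s| <= t -> s ^+ 2 <= t ^+ 2.
  move=> st; rewrite -(real_normK (num_real s)) lerXn2r ?nnegrE//.
  exact: le_trans (normr_ge0 _) st.
have c0 : 0 <= 1 + b + a by plra.
rewrite ler_wpM2l// lerD//; apply: sq; last first.
  by rewrite (le_trans (ler_normB _ _))// lerD2r.
rewrite normrM (gtr0_norm b0) ler_wpM2l ?(ltW b0)//.
by rewrite (le_trans (ler_normB _ _))// lerD2r.
Qed.

Lemma qP_ge z :
  (1 + b - a) * ((b * (z.1 - ptU)) ^+ 2 + (z.2 - b * ptV) ^+ 2) <= qP z.
Proof. by apply: quad_ge; left. Qed.

Lemma qQ_ge z :
  (1 + b - a) * ((b * (z.1 - ptV)) ^+ 2 + (z.2 - b * ptU) ^+ 2) <= qQ z.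
Proof. by apply: quad_ge; right. Qed.

Let c0 : 0 < 1 + b - a. Proof. by plra. Qed.

Lemma qP_ge0 z : 0 <= qP z.
Proof.
apply: le_trans (qP_ge z).
by rewrite mulr_ge0 ?(ltW c0)// addr_ge0 ?sqr_ge0.
Qed.

Lemma qP_eq0 z : qP z = 0 -> z = ptP.
Proof.
move=> q0; have := qP_ge z; rewrite q0 pmulr_rle0// => s0.
have s1 := sqr_ge0 (b * (z.1 - ptU)); have s2 := sqr_ge0 (z.2 - b * ptV).
have : (b * (z.1 - ptU)) ^+ 2 == 0 by rewrite eq_le s1 andbT; move: s0 s2; lra.
have : (z.2 - b * ptV) ^+ 2 == 0 by rewrite eq_le s2 andbT; move: s0 s1; lra.
rewrite !expf_eq0 /= mulf_eq0 !subr_eq0 (gt_eqF b0) /= => /eqP y0 /eqP x0.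
by rewrite [z]surjective_pairing x0 y0.
Qed.

(** In the notation of [qP_contraction], two steps lose [1 - b] times [u^2 + v^2], which is at least
    [(1 + b - a) / (2 + 2 a^2)] times [qP]. *)
Definition rate : R := 1 - (1 - b) * (1 + b - a) / (2 + 2 * a ^+ 2).

Let den0 : 0 < 2 + 2 * a ^+ 2.
Proof. by rewrite addr_gt0// mulr_gt0// exprn_gt0. Qed.

Lemma rate_bounds : 0 <= rate < 1.
Proof.
apply/andP; split.
  rewrite /rate subr_ge0 ler_pdivrMr// mul1r.
  by have := sqr_ge0 a => s0; pnra.
rewrite /rate gtrBl divr_gt0// mulr_gt0//; plra.
Qed.

(* The two squares lost by the form in two steps span the deviation. *)
Lemma qP_contraction z : 0 <= z.1 -> (L z).1 <= 0 ->
  qP (L (L z)) <= rate * qP z.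
Proof.
move=> z0 Lz0; rewrite (qP_L Lz0) (qQ_L z0); have [-> ->] := L_devP z0.
have := qP_ge z; rewrite /qP.
set x := z.1 - ptU; set y := z.2 - b * ptV => qge.
set u := a * b * x - _; set v := a * b * _ + _.
(* Half the gradient of the form in [b x] and [y] is [(v + a u, - u)], so this is Euler's identity;
   the lower eigenvalue [1 + b - a] then yields [c1]. *)
have key : quad 1 x y = - (y * u) + (b * x) * (v + a * u).
  by rewrite /quad /u /v; ring.
have c1 : (1 + b - a) * quad 1 x y <= u ^+ 2 + (v + a * u) ^+ 2.
  have s1 := sqr_ge0 ((1 + b - a) * y + u).
  have s2 := sqr_ge0 ((1 + b - a) * (b * x) - (v + a * u)).
  have cq : (1 + b - a) * ((1 + b - a) * ((b * x) ^+ 2 + y ^+ 2)) <=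
      (1 + b - a) * quad 1 x y by rewrite ler_wpM2l ?(ltW c0).
  have e : ((1 + b - a) * y + u) ^+ 2 +
      ((1 + b - a) * (b * x) - (v + a * u)) ^+ 2 =
      (1 + b - a) * ((1 + b - a) * ((b * x) ^+ 2 + y ^+ 2))
      - 2 * ((1 + b - a) * quad 1 x y) + (u ^+ 2 + (v + a * u) ^+ 2).
    by rewrite key; ring.
  by move: s1 s2 cq e; lra.
have c2 : (1 + b - a) * quad 1 x y <= (2 + 2 * a ^+ 2) * (u ^+ 2 + v ^+ 2).
  apply: (le_trans c1); rewrite -subr_ge0.
  have -> : (2 + 2 * a ^+ 2) * (u ^+ 2 + v ^+ 2) - (u ^+ 2 + (v + a * u) ^+ 2) =
      (v - a * u) ^+ 2 + u ^+ 2 + 2 * a ^+ 2 * v ^+ 2 by ring.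
  by rewrite !addr_ge0 ?sqr_ge0// mulr_ge0 ?sqr_ge0// mulr_ge0 ?sqr_ge0.
rewrite -subr_ge0 [X in 0 <= X](_ : _ = (1 - b) / (2 + 2 * a ^+ 2) *
    ((2 + 2 * a ^+ 2) * (u ^+ 2 + v ^+ 2) - (1 + b - a) * quad 1 x y)).
  by rewrite mulr_ge0 ?subr_ge0// divr_ge0 ?subr_ge0 ?(ltW den0)// ltW.
by rewrite /rate; field; rewrite gt_eqF.
Qed.

(** A point on the wrong side of the y-axis deviates horizontally from the cycle by at least [|ptU|]
    or [|ptV|], which bounds the form below. *)
Lemma qP_small : exists2 e, 0 < e &
  forall z, (qP z < e -> 0 < z.1) /\ (qQ z < e -> z.1 < 0).
Proof.
pose m s := (1 + b - a) * (b * s) ^+ 2.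
have m0 s : s != 0 -> 0 < m s.
  by move=> s0; rewrite mulr_gt0// exprn_even_gt0//= mulf_neq0// gt_eqF.
exists (Num.min (m ptU) (m ptV)).
  by rewrite lt_min !m0// ?(gt_eqF ptU_gt0)// (lt_eqF ptV_lt0).
have mono s t : `|s| <= `|t| -> m s <= m t.
  move=> st; rewrite ler_wpM2l ?(ltW c0)// !exprMn ler_wpM2l ?sqr_ge0//.
  by rewrite -(real_normK (num_real s)) -(real_normK (num_real t)) lerXn2r ?nnegrE.
have mle s t : m s <= (1 + b - a) * ((b * s) ^+ 2 + t ^+ 2).
  by rewrite ler_wpM2l ?(ltW c0)// lerDl sqr_ge0.
move=> z; rewrite !lt_min; split=> /andP[h1 h2]; rewrite ltNge; apply/negP => z0.
  move: h1; apply/negP; rewrite -leNgt (le_trans _ (qP_ge z))//.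
  apply: le_trans (mle _ _); apply: mono.
  have u0 := ptU_gt0; rewrite (gtr0_norm u0) ler0_norm; last by move: u0 z0; lra.
  by move: z0; lra.
move: h2; apply/negP; rewrite -leNgt (le_trans _ (qQ_ge z))//.
apply: le_trans (mle _ _); apply: mono.
have u0 := ptV_lt0; rewrite (ltr0_norm u0) ger0_norm; last by move: u0 z0; lra.
by move: z0; lra.
Qed.

Lemma qP_continuous : continuous qP.
Proof.
have cx : continuous (fun z : R * R => z.1 - ptU).
  by move=> z; apply: cvgB (cvg_cst _); exact: fst_continuous.
have cy : continuous (fun z : R * R => z.2 - b * ptV).
  by move=> z; apply: cvgB (cvg_cst _); exact: snd_continuous.
move=> z; rewrite /qP /quad; apply: cvgB; apply: cvgMr.
  apply: cvgD; apply: cvgM; try exact: cy; by apply: cvgMr; exact: cx.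
by apply: cvgM; [apply: cvgMr; exact: cx|exact: cy].
Qed.

Lemma qP_alternating z :
  (forall n, 0 <= (iter n.*2 L z).1 /\ (iter n.*2.+1 L z).1 <= 0) ->
  forall n, qP (iter n.*2 L z) <= rate ^+ n * qP z.
Proof.
move=> A; elim=> [|n IH]; first by rewrite expr0 mul1r.
have [r0 _] := andP rate_bounds; have [x0 x1] := A n.
rewrite doubleS !iterS (le_trans (qP_contraction x0 x1))//.
by rewrite exprS -mulrA ler_wpM2l.
Qed.

(** Since [qP] decreases to 0 along even times without vanishing, the orbit reaches a point [w] with
    [0 < qP w < e]. Near [w] all orbits alternate forever, and a level [c] crossed by [qP] in two
    steps prevents their return. *)
Lemma alternating_transient z :
  (forall n, 0 <= (iter n.*2 L z).1 /\ (iter n.*2.+1 L z).1 <= 0) ->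
  z <> ptP -> transient L z.
Proof.
move=> A zP; have [e e0 He] := qP_small; have [r0 r1] := andP rate_bounds.
have qz n : 0 < qP (iter n.*2 L z).
  rewrite lt_neqAle qP_ge0 andbT eq_sym; apply/eqP => /qP_eq0 E; apply: zP.
  have inj : injective (iter n.*2 L).
    have bN0 : b != 0 by rewrite gt_eqF.
    by elim: n.*2 => // m IH x y /= /(can_inj (@loziK _ a b bN0)) /IH.
  by apply: inj; rewrite E iter_L_ptP.
have [n qn] : exists n, qP (iter n.*2 L z) < e.
  have cr : (fun n => rate ^+ n * qP z) @ \oo --> (0 : R).
    by rewrite -(mul0r (qP z)); apply: cvgMl; apply: cvg_expr; rewrite ger0_norm.
  have /filter_ex[n Hn] : \forall n \near \oo, rate ^+ n * qP z < e.
      exact: (cvgr_lt _ cr _ e0).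
  by exists n; exact: le_lt_trans (qP_alternating A n) Hn.
apply: (@transient_iter _ _ (@lozi_continuous _ _ _) n.*2).
have := A n; rewrite iterS => -[].
move: (iter n.*2 L z) (qz n) qn => w qw qwe x0 x1.
have drop : qP (L (L w)) < qP w.
  by rewrite (le_lt_trans (qP_contraction x0 x1))// gtr_pMl.
pose c := (qP (L (L w)) + qP w) / 2.
have cL : continuous (fun y => qP (L (L y))).
  have LC : continuous L by exact: lozi_continuous.
  move=> y; apply: (@continuous_comp _ _ _ L (fun y => qP (L y))); first exact: LC.
  by apply: (@continuous_comp _ _ _ L qP); [exact: LC|exact: qP_continuous].
exists [set y | [/\ qP y < e, c < qP y & qP (L (L y)) < c]].
  near=> y; split; near: y.
  - exact: (cvgr_lt _ (qP_continuous (x := w)) _ qwe).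
  - by apply: (cvgr_gt _ (qP_continuous (x := w))); rewrite /c midf_lt.
  - by apply: (cvgr_lt _ (cL w)); rewrite /c midf_lt.
have step y : qP y < e -> [/\ 0 < y.1, (L y).1 < 0 & qP (L (L y)) <= qP y].
  move=> ye; have y0 := (He y).1 ye; have qL := qQ_L_le (ltW y0).
  have Ly0 := (He (L y)).2 (le_lt_trans qL ye); split=> //.
  by rewrite (le_trans (qP_L_le (ltW Ly0))).
exists 2 => y m m2 [ye _ yc].
have stay j : qP (iter j.*2 L y) < e /\ ((0 < j)%N -> qP (iter j.*2 L y) < c).
  elim: j => [|j [IH1 IH2]] //; have [_ _ le] := step _ IH1.
  rewrite doubleS !iterS; split=> [|_]; first exact: le_lt_trans le IH1.
  by case: j IH1 IH2 le => // j IH1 IH2 le; exact: le_lt_trans le (IH2 _).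
(* At odd times the orbit is in the left half-plane, where [qP] cannot be below [e]; at positive
   even times [qP] is below [c]. *)
rewrite -(odd_double_half m) => -[].
have [qe qc] := stay m./2; case: (odd m) => /=.
  have [_ neg _] := step _ qe; rewrite ?add1n ?iterS => /(He _).1.
  by move=> /(lt_trans neg); rewrite ltxx.
rewrite ?add0n => _ + _; apply/negP; rewrite -leNgt ltW//; apply: qc.
by rewrite half_gt0.
Unshelve. all: by end_near. Qed.

(** Contraction along the backward orbit gives [qP w <= rate ^+ n * qP (z n) <= rate ^+ n * B] for
    all [n]. *)
Lemma ptP_alternating_backward w (z : nat -> R * R) (B : R) :
  z 0 = w -> (forall n, L (L (z n.+1)) = z n) ->
  (forall n, 0 <= (z n).1 /\ (L (z n)).1 <= 0) -> (forall n, qP (z n) <= B) ->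
  w = ptP.
Proof.
move=> <- zL zA zB; apply: qP_eq0; apply: (geometric_eq0 rate_bounds) => n.
rewrite ger0_norm ?qP_ge0//; have [r0 _] := andP rate_bounds.
apply: le_trans (_ : rate ^+ n * qP (z n) <= _); last first.
  by rewrite ler_wpM2l// exprn_ge0.
elim: n => [|n IH]; first by rewrite expr0 mul1r.
rewrite (le_trans IH)// exprSr -mulrA ler_wpM2l ?exprn_ge0// -zL.
by have [x0 x1] := zA n.+1; exact: qP_contraction.
Qed.

End PeriodTwoOrbit.

(** * Nontransient points of the Lozi map *)

Section Eigencoordinates.
Variables (R : realType) (k l : R).
(** Here [kl1] says [b < 1], [kl] says [a < 1 + b], and [1 - b < a] follows from
    [a + b - 1 = (k - 1) * (1 + l)]. *)
Hypotheses (l0 : 0 < l) (l1 : l < 1) (k1 : 1 < k).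
Hypotheses (kl1 : k * l < 1) (kl : k * (1 - l) < 1 + l).

Local Notation a := (k - l).
Local Notation b := (k * l).
Local Notation L := (lozi a b).
Local Notation Li := (lozi_inv a b).
Local Notation NT z := (~ transient L z).

Local Ltac plra := move: l0 l1 k1 kl1 kl; lra.
Local Ltac pnra := move: l0 l1 k1 kl1 kl; nra.

Let k0 : 0 < k. Proof. by plra. Qed.
Let a0 : 0 < a. Proof. by plra. Qed.
Let b0 : 0 < b. Proof. exact: mulr_gt0. Qed.
Let bN0 : b != 0. Proof. by rewrite gt_eqF. Qed.

Lemma LK : cancel L Li. Proof. exact: loziK. Qed.
Lemma LiK : cancel Li L. Proof. exact: lozi_invK. Qed.

Lemma lozi_right z : 0 <= z.1 -> L z = (1 + z.2 - a * z.1, b * z.1).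
Proof. by move=> z0; rewrite /lozi ger0_norm. Qed.

Lemma lozi_left z : z.1 <= 0 -> L z = (1 + z.2 + a * z.1, b * z.1).
Proof. by move=> z0; rewrite /lozi ler0_norm// mulrN opprK. Qed.

Lemma nontransient_lozi z : NT z -> NT (L z).
Proof. by move=> ntz /(transient_image (@lozi_continuous _ _ _)). Qed.

Lemma nontransient_iter n z : NT z -> NT (iter n L z).
Proof. by elim: n => //= n IH /IH /nontransient_lozi. Qed.

Lemma nontransient_lozi_inv z : NT z -> NT (Li z).
Proof.
move=> ntz; apply: contra_not ntz.
exact: (transient_preimage (@lozi_inv_continuous _ _ _) LK LiK).
Qed.

Lemma nontransient_iter_inv n z : NT z -> NT (iter n Li z).
Proof. by elim: n => //= n IH /IH /nontransient_lozi_inv. Qed.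

(* The linearization at X has the eigenvalues l and -k, with left eigenforms
   mu and ep; the one at Y has k and -l, with left eigenforms ga and et. *)
Definition mu (z : R * R) := (1 - l) * (l * z.1 + z.2) - l.
Definition ga (z : R * R) := (k - 1) * (k * z.1 + z.2) + k.
Definition ep (z : R * R) := (1 + k) * (z.2 - k * z.1) + k.
Definition et (z : R * R) := (1 + l) * (z.2 - l * z.1) + l.

Lemma mu_right z : 0 <= z.1 -> mu (L z) = l * mu z.
Proof. by move=> /lozi_right ->; rewrite /mu /=; ring. Qed.

Lemma mu_left z : z.1 <= 0 -> mu (L z) = l * mu z + 2 * (1 - l) * l * a * z.1.
Proof. by move=> /lozi_left ->; rewrite /mu /=; ring. Qed.

Lemma ga_left z : z.1 <= 0 -> ga (L z) = k * ga z.
Proof. by move=> /lozi_left ->; rewrite /ga /=; ring. Qed.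

Lemma ga_right z : 0 <= z.1 -> ga (L z) = k * ga z - 2 * (k - 1) * k * a * z.1.
Proof. by move=> /lozi_right ->; rewrite /ga /=; ring. Qed.

Lemma ep_right z : 0 <= z.1 -> ep (L z) = - k * ep z.
Proof. by move=> /lozi_right ->; rewrite /ep /=; ring. Qed.

Lemma et_left z : z.1 <= 0 -> et (L z) = - l * et z.
Proof. by move=> /lozi_left ->; rewrite /et /=; ring. Qed.

Definition ptX : R * R := let x := ((1 + k) * (1 - l))^-1 in (x, b * x).
Definition ptY : R * R := let x := - ((k - 1) * (1 + l))^-1 in (x, b * x).

Lemma ptX_gt0 : 0 < ptX.1.
Proof. by rewrite /= invr_gt0 mulr_gt0//; plra. Qed.

Lemma ptY_lt0 : ptY.1 < 0.
Proof. by rewrite /= oppr_lt0 invr_gt0 mulr_gt0//; plra. Qed.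

Lemma L_ptX : L ptX = ptX.
Proof.
rewrite lozi_right ?(ltW ptX_gt0)//; congr (_, _) => /=.
by field; rewrite !gt_eqF//; plra.
Qed.

Lemma L_ptY : L ptY = ptY.
Proof.
rewrite lozi_left ?(ltW ptY_lt0)//; congr (_, _) => /=.
by field; rewrite !gt_eqF//; plra.
Qed.

Lemma mu_ep_eq0 z : mu z = 0 -> ep z = 0 -> z = ptX.
Proof.
case: z => x y; rewrite /mu /ep /ptX /= => m0 e0.
have E1 : (1 - l) * (1 + k) * x = 1 by pnra.
have xE : x = ((1 + k) * (1 - l))^-1.
  apply: (mulfI (x := (1 + k) * (1 - l))).
    by rewrite gt_eqF// mulr_gt0//; plra.
  by rewrite divff ?gt_eqF ?mulr_gt0//; plra.
rewrite -xE; congr (_, _); rewrite -[LHS]subr0.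
have c0 : 1 + k != 0 by rewrite gt_eqF//; plra.
by apply: (mulfI c0); pnra.
Qed.

Lemma ga_et_eq0 z : ga z = 0 -> et z = 0 -> z = ptY.
Proof.
case: z => x y; rewrite /ga /et /ptY /= => m0 e0.
have E1 : (k - 1) * (1 + l) * x = -1 by pnra.
have xE : x = - ((k - 1) * (1 + l))^-1.
  apply: (mulfI (x := (k - 1) * (1 + l))).
    by rewrite gt_eqF// mulr_gt0//; plra.
  by rewrite mulrN divff ?gt_eqF ?mulr_gt0//; plra.
rewrite -xE; congr (_, _).
have c0 : 1 + l != 0 by rewrite gt_eqF//; plra.
by apply: (mulfI c0); pnra.
Qed.

Lemma mu_continuous : continuous mu.
Proof.
move=> z; apply: cvgB (cvg_cst _); apply: cvgMr.
apply: cvgD; last exact: snd_continuous.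
by apply: cvgMr; exact: fst_continuous.
Qed.

Lemma ga_continuous : continuous ga.
Proof.
move=> z; apply: cvgD (cvg_cst _); apply: cvgMr.
apply: cvgD; last exact: snd_continuous.
by apply: cvgMr; exact: fst_continuous.
Qed.

Lemma mu_L_le z : mu (L z) <= l * mu z.
Proof.
have [z0|z0] := leP 0 z.1; first by rewrite mu_right.
rewrite mu_left ?(ltW z0)// gerDl mulr_ge0_le0 ?(ltW z0)//.
by rewrite mulr_ge0 ?(ltW a0)// mulr_ge0 ?(ltW l0)// mulr_ge0//; plra.
Qed.

Lemma ga_L_le z : ga (L z) <= k * ga z.
Proof.
have [z0|z0] := leP z.1 0; first by rewrite ga_left.
rewrite ga_right ?(ltW z0)// gerBl mulr_ge0 ?(ltW z0)//.
by rewrite mulr_ge0 ?(ltW a0)// mulr_ge0 ?(ltW k0)// mulr_ge0//; plra.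
Qed.

(** The maximum of [mu] and 0 is a Lyapunov function, strictly decreasing where [mu] is positive
    because [l < 1]. *)
Lemma nontransient_mu_le0 z : NT z -> mu z <= 0.
Proof.
move=> ntz; rewrite leNgt; apply/negP => m0; apply: ntz.
apply: (@transient_lyapunov _ _ (@lozi_continuous _ _ _) _
  (fun y => Num.max (mu y) 0)).
- by move=> y; apply: continuous_max; [exact: mu_continuous|exact: cvg_cst].
- move=> y; have := mu_L_le y; have [m|m] := leP (mu y) 0 => mL.
    by rewrite ge_max lexx andbT; pnra.
  by rewrite ge_max (ltW m) andbT; pnra.
- have := mu_L_le z => mL; rewrite [X in _ < X]max_l ?(ltW m0)// gt_max m0 andbT.
  by pnra.
Qed.

Lemma nontransient_ga_ge0 z : NT z -> 0 <= ga z.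
Proof.
move=> ntz; rewrite leNgt; apply/negP => m0; apply: ntz.
apply: (@transient_lyapunov _ _ (@lozi_continuous _ _ _) _
  (fun y => Num.min (ga y) 0)).
- by move=> y; apply: continuous_min; [exact: ga_continuous|exact: cvg_cst].
- move=> y; have := ga_L_le y; have [m|m] := leP 0 (ga y) => mL.
    by rewrite ge_min lexx orbT.
  by rewrite ge_min; apply/orP; left; pnra.
- have := ga_L_le z => mL; rewrite [X in _ < X]min_l ?(ltW m0)// gt_min.
  by apply/orP; left; pnra.
Qed.

(* Points z alternating forever between the two half-planes form a convex set
   on which L^2 is affine; it is homogenized to a convex cone of triples
   (x, y, c), the triple (x, y, 1) standing for the point (x, y). *)
Definition comb (t : R) (w : R * R * R) (s : R) (w' : R * R * R) : R * R * R :=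
  (t * w.1.1 + s * w'.1.1, t * w.1.2 + s * w'.1.2, t * w.2 + s * w'.2).

(** Homogenized versions: [phi] is the abscissa after the right branch of the map, [F] is the right
    branch followed by the left one, and [hmu] is [mu]. *)
Definition phi (w : R * R * R) : R := w.2 + w.1.2 - a * w.1.1.

Definition F (w : R * R * R) : R * R * R :=
  (w.2 + b * w.1.1 + a * phi w, b * phi w, w.2).

Definition hmu (w : R * R * R) : R := (1 - l) * (l * w.1.1 + w.1.2) - l * w.2.

Definition lift (z : R * R) : R * R * R := (z, 1).

Definition altF w := forall n, 0 <= (iter n F w).1.1 /\ phi (iter n F w) <= 0.

Definition cone w := [/\ 0 <= w.2, hmu w <= 0 & altF w].

Definition alt z := forall n, 0 <= (iter n.*2 L z).1 /\ (iter n.*2.+1 L z).1 <= 0.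

Lemma F_comb t w s w' : F (comb t w s w') = comb t (F w) s (F w').
Proof. by rewrite /F /comb /phi /=; congr (_, _, _); ring. Qed.

Lemma phi_comb t w s w' : phi (comb t w s w') = t * phi w + s * phi w'.
Proof. by rewrite /phi /comb /=; ring. Qed.

Lemma hmu_comb t w s w' : hmu (comb t w s w') = t * hmu w + s * hmu w'.
Proof. by rewrite /hmu /comb /=; ring. Qed.

Lemma iter_F_comb n t w s w' :
  iter n F (comb t w s w') = comb t (iter n F w) s (iter n F w').
Proof. by elim: n => [//|n IH]; rewrite !iterS IH F_comb. Qed.

Lemma cone_comb t w s w' : 0 <= t -> 0 <= s -> cone w -> cone w' ->
  cone (comb t w s w').
Proof.
move=> t0 s0 [c0 m0 A] [c0' m0' A']; split.
- by rewrite /= addr_ge0// mulr_ge0.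
- rewrite hmu_comb -oppr_ge0 opprD -!mulrN.
  by rewrite addr_ge0// mulr_ge0// oppr_ge0.
- move=> n; have [x0 p0] := A n; have [x0' p0'] := A' n.
  rewrite iter_F_comb phi_comb; split; first by rewrite /= addr_ge0// mulr_ge0.
  rewrite -oppr_ge0 opprD -!mulrN.
  by rewrite addr_ge0// mulr_ge0// oppr_ge0.
Qed.

Lemma hmu_F w : hmu (F w) = l ^+ 2 * hmu w + 2 * (1 - l) * l * a * phi w.
Proof. by rewrite /hmu /F /phi /=; ring. Qed.

Lemma cone_F w : cone w -> cone (F w).
Proof.
move=> [c0 m0 A]; split=> //; last by move=> n; rewrite -iterSr; exact: A.
rewrite hmu_F -oppr_ge0 opprD -!mulrN addr_ge0// mulr_ge0 ?oppr_ge0//.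
- by rewrite sqr_ge0.
- by rewrite mulr_ge0 ?(ltW a0)// mulr_ge0 ?(ltW l0)// mulr_ge0//; plra.
- exact: (A 0%N).2.
Qed.

Lemma phi_lift z : 0 <= z.1 -> (L z).1 = phi (lift z).
Proof. by move=> z0; rewrite lozi_right. Qed.

Lemma lozi2_lift z : 0 <= z.1 -> (L z).1 <= 0 -> lift (L (L z)) = F (lift z).
Proof.
move=> z0 Lz0; rewrite /F -phi_lift// (lozi_left Lz0) /lift /=.
by congr (_, _, _); rewrite ger0_norm//; ring.
Qed.

Lemma cone_alt z : cone (lift z) -> alt z.
Proof.
move=> [_ _ A].
have it n : lift (iter n.*2 L z) = iter n F (lift z).
  elim: n => [//|n IH]; rewrite doubleS !iterS lozi2_lift ?IH//.
    by have := (A n).1; rewrite -IH.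
  rewrite phi_lift; first by rewrite IH; exact: (A n).2.
  by have := (A n).1; rewrite -IH.
move=> n; have [x0 p0] := A n; rewrite -it /= in x0; split=> //.
by rewrite iterS phi_lift// it.
Qed.

Lemma alt_cone z : mu z <= 0 -> alt z -> cone (lift z).
Proof.
move=> m0 A; split; rewrite ?ler01//; first by rewrite /hmu mulr1.
have it n : lift (iter n.*2 L z) = iter n F (lift z).
  elim: n => [//|n IH]; have [x0 p0] := A n.
  by rewrite doubleS !iterS lozi2_lift ?IH.
move=> n; have [x0 p0] := A n; rewrite -it; split => //.
by rewrite -phi_lift.
Qed.

(** * Regions of the right half-plane controlled by the orbit of Z *)

Hypothesis altZ : alt ((1 - l)^-1, 0).

(** The triple is [1 - l] times the lift of Z, a point where [mu] vanishes; [comb t w 0 w] serves as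
    the multiple of [w] by [t]. *)
Lemma cone_Z : cone (1, 0, 1 - l).
Proof.
have l1' : 1 - l != 0 by rewrite gt_eqF//; plra.
have -> : (1, 0, 1 - l) =
    comb (1 - l) (lift ((1 - l)^-1, 0)) 0 (lift ((1 - l)^-1, 0)).
  by rewrite /comb /lift /=; congr (_, _, _); field.
have c : cone (lift ((1 - l)^-1, 0)).
  apply: alt_cone altZ; rewrite /mu /= addr0 mulrCA divff//.
  by rewrite mulr1 subrr.
by apply: cone_comb => //; plra.
Qed.

(** This triple represents the second preimage of Z: it lies on the unstable line of X, [phi]
    vanishes there, and [F] sends it to [k] times the triple of Z. *)
Lemma cone_preZ : cone (1, l * (k - 1), k * (1 - l)).
Proof.
have FE : F (1, l * (k - 1), k * (1 - l)) = comb k (1, 0, 1 - l) 0 (1, 0, 1 - l).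
  by rewrite /F /comb /phi /=; congr (_, _, _); ring.
split.
- by rewrite /= mulr_ge0//; plra.
- by rewrite /hmu /= le_eqVlt; apply/orP; left; apply/eqP; ring.
case=> [|n].
  split=> /=; first exact: ler01.
  by rewrite /phi /= le_eqVlt; apply/orP; left; apply/eqP; ring.
rewrite iterSr FE.
by have [_ _] := cone_comb (ltW k0) (lexx 0) cone_Z cone_Z; apply.
Qed.

(* The point (1/a, 0), where the x-axis meets L^-1 of the y-axis, is mapped by
   L^2 into the segment joining it to Z. *)
Lemma cone_o : cone (1, 0, a).
Proof.
have FE : F (1, 0, a) = comb (l ^+ 2) (1, 0, a) (a * (1 + l)) (1, 0, 1 - l).
  by rewrite /F /comb /phi /=; congr (_, _, _); ring.
have [_ _ AZ] := cone_Z.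
split.
- exact: ltW.
- have -> : hmu (1, 0, a) = l * (1 - k) by rewrite /hmu /=; ring.
  by rewrite mulr_ge0_le0//; plra.
elim=> [|n [IHx IHp]].
  by split=> /=; rewrite ?ler01// /phi /= addr0 mulr1 subrr.
have [xZ pZ] := AZ n.
have t0 : 0 <= l ^+ 2 by rewrite sqr_ge0.
have s0 : 0 <= a * (1 + l) by rewrite mulr_ge0 ?(ltW a0)//; plra.
rewrite iterSr FE iter_F_comb phi_comb; split.
  by rewrite /= addr_ge0// mulr_ge0.
rewrite -oppr_ge0 opprD -!mulrN.
by rewrite addr_ge0// mulr_ge0// oppr_ge0.
Qed.

(** The inequalities cut out the triangle with vertices [(1/a, 0)], Z and the second preimage of Z.
    The coefficient of each vertex is a multiple of the form vanishing on the opposite side. *)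
Lemma cone_triangle z : 0 <= z.2 -> mu z <= 0 -> phi (lift z) <= 0 ->
  cone (lift z).
Proof.
case: z => x y /= y0 m0 p0.
have k1' : 0 < k - 1 by plra.
have lk0 : 0 < l * (k - 1) by rewrite mulr_gt0.
have -> : lift (x, y) =
    comb 1 (comb (- mu (x, y) / (l * (k - 1))) (1, 0, a)
                 (y / (l * (k - 1))) (1, l * (k - 1), k * (1 - l)))
         (- phi (lift (x, y)) / (k - 1)) (1, 0, 1 - l).
  rewrite /comb /lift /mu /phi /=.
  by congr (_, _, _); field; rewrite !gt_eqF.
apply: cone_comb; rewrite ?ler01// ?divr_ge0 ?oppr_ge0 ?(ltW k1')//.
- apply: cone_comb; rewrite ?divr_ge0 ?oppr_ge0 ?(ltW lk0)//.
    exact: cone_o.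
  exact: cone_preZ.
- exact: cone_Z.
Qed.

(* The points from which an orbit cannot visit the left half-plane twice in a
   row before visiting the right one twice in a row. *)
Definition guard (w : R * R * R) :=
  exists e d t, [/\ cone e, 0 <= d, 0 <= t &
    w = comb 1 e 1 (comb d (0, 0, 1) t (0, - b, a))].

Lemma guard_comb t w s w' : 0 <= t -> 0 <= s -> guard w -> guard w' ->
  guard (comb t w s w').
Proof.
move=> t0 s0 [e [d [u [ce d0 u0 ->]]]] [e' [d' [u' [ce' d0' u0' ->]]]].
exists (comb t e s e'), (t * d + s * d'), (t * u + s * u'); split.
- exact: cone_comb.
- by rewrite addr_ge0// mulr_ge0.
- by rewrite addr_ge0// mulr_ge0.
- by rewrite /comb /=; congr (_, _, _); ring.
Qed.

Lemma cone_guard w : cone w -> guard w.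
Proof.
by move=> cw; exists w, 0, 0; split=> //; case: w {cw} => [[x y] c];
  rewrite /comb /=; congr (_, _, _); ring.
Qed.

(** These triples describe the segment from the origin to Z. *)
Lemma guard_axis x c : 0 <= x -> (1 - l) * x <= c -> guard (x, 0, c).
Proof.
move=> x0 xc; exists (comb x (1, 0, 1 - l) 0 (1, 0, 1 - l)), (c - (1 - l) * x), 0.
split; rewrite ?subr_ge0//; first by apply: cone_comb => //; exact: cone_Z.
by rewrite /comb /=; congr (_, _, _); ring.
Qed.

Definition below (w : R * R * R) := [/\ 0 <= w.1.1, 0 <= w.2 & hmu w <= 0].

Lemma below_comb t w s w' : 0 <= t -> 0 <= s -> below w -> below w' ->
  below (comb t w s w').
Proof.
move=> t0 s0 [x0 c0 m0] [x0' c0' m0']; split.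
- by rewrite /= addr_ge0// mulr_ge0.
- by rewrite /= addr_ge0// mulr_ge0.
- rewrite hmu_comb -oppr_ge0 opprD -!mulrN.
  by rewrite addr_ge0// mulr_ge0// oppr_ge0.
Qed.

Lemma guard_below w : guard w -> below w.
Proof.
have bO : below (0, 0, 1).
  split=> //=; rewrite /hmu /= ?mulr1 ?mulr0 ?addr0 ?mulr0 ?sub0r ?oppr_le0.
  exact: ltW.
have bV : below (0, - b, a).
  split=> //=; first exact: ltW.
  have -> : hmu (0, - b, a) = - ((1 - l) * b + l * a) by rewrite /hmu /=; ring.
  by rewrite oppr_le0 addr_ge0// mulr_ge0 ?(ltW a0) ?(ltW b0) ?(ltW l0)//; plra.
move=> [e [d [t [[c0 m0 A] d0 t0 ->]]]].
apply: below_comb; rewrite ?ler01//; last exact: below_comb.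
by split=> //; exact: (A 0%N).1.
Qed.

(** When [phi] vanishes, [F w] is on the x-axis, and [hmu (F w) <= 0] places it no farther right
    than Z. *)
Lemma guard_F_boundary w : below w -> phi w = 0 -> guard (F w).
Proof.
move=> [x0 c0 m0] p0; rewrite /F p0 !mulr0 addr0; apply: guard_axis.
  by rewrite addr_ge0// mulr_ge0 ?(ltW b0).
have : hmu (F w) <= 0.
  by rewrite hmu_F p0 mulr0 addr0 mulr_ge0_le0// sqr_ge0.
rewrite /hmu /F p0 /= !mulr0 !addr0 mulrCA -mulrBr pmulr_rle0//.
by rewrite subr_le0.
Qed.

(** The sum splits as [d + s e], with [s] chosen so that [phi] vanishes there, plus the multiple
    [(1 - s) e]. Both images are guarded, and [F] is linear. *)
Lemma guard_F_crossing d e : below d -> below e -> 0 <= phi d -> phi e <= 0 ->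
  guard (F e) -> phi (comb 1 d 1 e) <= 0 -> guard (F (comb 1 d 1 e)).
Proof.
move=> bd be pd pe Ge; rewrite phi_comb !mul1r => pde.
move: (pe); rewrite le_eqVlt => /orP[/eqP pe0|pe0].
  apply: guard_F_boundary; first exact: below_comb.
  rewrite phi_comb !mul1r pe0 addr0; apply: le_anti; rewrite pd andbT.
  by move: pde; rewrite pe0 addr0.
pose s := phi d / - phi e.
have s0 : 0 <= s by rewrite divr_ge0// oppr_ge0.
have s1 : s <= 1.
  by rewrite ler_pdivrMr ?oppr_gt0// mul1r -[leRHS]add0r lerBrDr.
have -> : comb 1 d 1 e = comb 1 (comb 1 d s e) (1 - s) e.
  by rewrite /comb /=; congr (_, _, _); ring.
rewrite F_comb; apply: guard_comb => //; first by rewrite subr_ge0.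
apply: guard_F_boundary; first exact: below_comb.
by rewrite phi_comb mul1r /s; field; rewrite lt_eqF.
Qed.

(** The sign of [a - b], the value of [phi] at [(0, - b, a)], decides whether that generator joins
    the origin or the cone part in [guard_F_crossing]. *)
Lemma guard_F w : guard w -> phi w <= 0 -> guard (F w).
Proof.
have bO : below (0, 0, 1).
  by apply: guard_below; apply: guard_axis; rewrite ?mulr0.
have gV t : 0 <= t -> guard (comb t (0, - b, a) 0 (0, 0, 1)).
  move=> t0; exists (comb 0 (1, 0, 1 - l) 0 (1, 0, 1 - l)), 0, t.
  split=> //; first by apply: cone_comb => //; exact: cone_Z.
  by rewrite /comb /=; congr (_, _, _); ring.
move=> [e [d [t [ce d0 t0 ->]]]].
have be := guard_below (cone_guard ce).
have pe : phi e <= 0 by have [_ _ A] := ce; exact: (A 0%N).2.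
have [ab|ab] := leP b a.
  have -> : comb 1 e 1 (comb d (0, 0, 1) t (0, - b, a)) =
      comb 1 (comb d (0, 0, 1) 1 (comb t (0, - b, a) 0 (0, 0, 1))) 1 e.
    by rewrite /comb /=; congr (_, _, _); ring.
  apply: guard_F_crossing => //; last exact/cone_guard/cone_F.
    by apply: below_comb => //; exact/guard_below/gV.
  have -> : phi (comb d (0, 0, 1) 1 (comb t (0, - b, a) 0 (0, 0, 1))) =
      d + t * (a - b) by rewrite /phi /comb /=; ring.
  by rewrite addr_ge0// mulr_ge0// subr_ge0.
have -> : comb 1 e 1 (comb d (0, 0, 1) t (0, - b, a)) =
    comb 1 (comb d (0, 0, 1) 0 (0, 0, 1))
         1 (comb 1 e 1 (comb t (0, - b, a) 0 (0, 0, 1))).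
  by rewrite /comb /=; congr (_, _, _); ring.
have pV : phi (comb t (0, - b, a) 0 (0, 0, 1)) = t * (a - b).
  by rewrite /phi /comb /=; ring.
apply: guard_F_crossing => //.
- exact: below_comb.
- by apply: below_comb => //; exact/guard_below/gV.
- by rewrite phi_comb /phi /=; nra.
- have : t * (a - b) <= 0 by rewrite mulr_ge0_le0// subr_le0 ltW.
  by rewrite phi_comb !mul1r pV; move: pe; lra.
rewrite F_comb; apply: guard_comb; rewrite ?ler01//.
  exact/cone_guard/cone_F.
(* [F] moves the point [(0, - b/a)] into the segment joining it to [(1, 0)], which lies between the
   origin and Z. *)
have -> : F (comb t (0, - b, a) 0 (0, 0, 1)) =
    comb (t * (b - a)) (comb 1 (0, - b, a) 0 (0, 0, 1))
         (t * a * ((1 + k) * (1 - l))) (1, 0, 1).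
  by rewrite /F /phi /comb /=; congr (_, _, _); ring.
apply: guard_comb.
- by rewrite mulr_ge0// subr_ge0 ltW.
- by rewrite mulr_ge0 ?mulr_ge0 ?(ltW a0)//; plra.
- exact: gV.
- by apply: guard_axis; rewrite ?ler01// mulr1; plra.
Qed.

(** The triangle has vertices the origin, [(1, 0)] and [(0, - b/a)]; the first two lie on the
    segment from the origin to Z. *)
Lemma guard_triangle z : 0 <= z.1 -> z.2 <= 0 -> b * z.1 <= b + a * z.2 ->
  guard (lift z).
Proof.
case: z => x y /= x0 y0 xy.
exists (comb x (1, 0, 1 - l) 0 (1, 0, 1 - l)),
  (x * l + (b + a * y - b * x) / b), (- y / b).
have yb : 0 <= - y / b by rewrite divr_ge0 ?oppr_ge0 ?(ltW b0).
split=> //.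
- by apply: cone_comb => //; exact: cone_Z.
- by rewrite addr_ge0 ?mulr_ge0 ?(ltW l0)// ?invr_ge0 ?(ltW b0)// subr_ge0.
- rewrite /comb /lift /=.
  by congr (_, _, _); field; rewrite !gt_eqF// (lt_trans _ k1).
Qed.

(** * Itineraries of nontransient points *)

Local Notation P := (ptP a b).
Local Notation Q := (ptQ a b).

Let ab1 : 1 - b < a. Proof. by pnra. Qed.
Let ab2 : a < 1 + b. Proof. by plra. Qed.

Lemma P1_gt0 : 0 < P.1. Proof. exact: ptU_gt0. Qed.
Lemma Q1_lt0 : Q.1 < 0. Proof. exact: ptV_lt0. Qed.
Lemma lozi_P : L P = Q. Proof. exact: L_ptP. Qed.
Lemma lozi_Q : L Q = P. Proof. exact: L_ptQ. Qed.

Lemma nontransient_alternating z : NT z -> alt z -> z = P.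
Proof.
by move=> ntz az; apply: contrapT => zP; apply: ntz; exact: alternating_transient.
Qed.

Lemma alt_triangle z : 0 <= z.1 -> 0 <= z.2 -> mu z <= 0 -> (L z).1 <= 0 -> alt z.
Proof.
move=> x0 y0 m0 L0; apply/cone_alt/cone_triangle => //.
by rewrite -phi_lift.
Qed.

Lemma alt_lozi2 z : alt z -> alt (L (L z)).
Proof.
move=> A n; have := A n.+1; rewrite doubleS.
by rewrite (iterSr n.*2.+1) (iterSr n.*2) (iterSr n.*2.+2) (iterSr n.*2.+1).
Qed.

(* Such an orbit contracts mu as long as it stays in the right half-plane; once
   it leaves, it alternates. *)
Lemma transient_right z : 0 < z.1 -> 0 < (L z).1 -> mu z < 0 -> transient L z.
Proof.
move=> x0 Lx0 m0; pose c := (mu z + l * mu z) / 2.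
have lm : mu z < l * mu z by pnra.
exists [set y | [/\ 0 < y.1, 0 < (L y).1, mu y < c & c < l * mu y]].
  have LC : continuous L by exact: lozi_continuous.
  have cL : continuous (fun y => (L y).1).
    move=> y; apply: (@continuous_comp _ _ _ L (fun y => y.1)); first exact: LC.
    exact: fst_continuous.
  have cm : continuous (fun y => l * mu y).
    by move=> y; apply: cvgMr; exact: mu_continuous.
  near=> y; split; near: y.
  - exact: (cvgr_gt _ (fst_continuous (x := z)) _ x0).
  - exact: (cvgr_gt _ (cL z) _ Lx0).
  - by apply: (cvgr_lt _ (mu_continuous (x := z))); rewrite /c midf_lt.
  - by apply: (cvgr_gt _ (cm z)); rewrite /c midf_lt.
have c0 : c < 0 by rewrite /c; pnra.
exists 1 => y [//|n] _ [y0 Ly0 yc cy].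
have mLy : mu (L y) = l * mu y by rewrite mu_right// ltW.
(* Forward invariant, and disjoint from the neighbourhood: either [mu] exceeds [c], or one of [w]
   and [L w] is not strictly to the right. *)
pose S w := [\/ [/\ 0 <= w.1, 0 <= w.2, c < mu w & mu w <= 0], alt w |
  w.1 <= 0 /\ alt (L w)].
have SL w : S w -> S (L w).
  case=> [[w0 w20 cw w0']|aw|[_ aw]]; last by constructor 2.
  - have [Lw0|Lw0] := leP 0 (L w).1.
      have mLw : mu (L w) = l * mu w by rewrite mu_right.
      constructor 1; rewrite mLw; split=> //; first by rewrite mulr_ge0// ltW.
        by pnra.
      by rewrite mulr_ge0_le0// ltW.
    constructor 3; split; first exact: ltW.
    by apply/alt_lozi2/alt_triangle => //; exact: ltW.
  - by constructor 3; split; [have [] := aw 0|exact: alt_lozi2].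
have : S (iter n.+1 L y).
  elim: n => [|n IH]; last by rewrite iterS; exact: SL.
  constructor 1; rewrite /= -/(L y) mLy; split=> //; first exact: ltW.
    by rewrite mulr_ge0// ltW.
  by pnra.
case=> [[_ _ cw _]|aw|[aw _]] [w1 w2 w3 _].
- by move: (lt_trans cw w3); rewrite ltxx.
- by have [_] := aw 0; rewrite leNgt => /negP; apply.
- by move: aw; rewrite leNgt => /negP; apply.
Unshelve. all: by end_near. Qed.

Lemma norm_ep_bounded : exists B, forall z, 0 <= z.1 -> 0 <= z.2 -> mu z <= 0 ->
  `|ep z| <= B.
Proof.
have l1' : 0 < 1 - l by plra.
exists ((1 + k) * (1 - l)^-1 * (l + k) + k) => -[x y] /= x0 y0.
rewrite /mu /ep /= => m0.
have hx : x <= (1 - l)^-1.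
  rewrite -[leRHS]mul1r ler_pdivlMr// -(ler_pM2l l0).
  by have := mulr_ge0 (ltW l1') y0; move: m0; lra.
have hy : y <= (1 - l)^-1 * l.
  rewrite mulrC ler_pdivlMr//.
  by have := mulr_ge0 (mulr_ge0 (ltW l1') (ltW l0)) x0; move: m0; lra.
have h : `|y - k * x| <= (1 - l)^-1 * (l + k).
  rewrite (le_trans (ler_normB _ _))// mulrDr lerD// ger0_norm//.
    by rewrite mulrC ler_wpM2r// ltW.
  by rewrite mulr_ge0// ltW.
rewrite (le_trans (ler_normD _ _))// (gtr0_norm k0) lerD2r normrM.
have k1' : 0 <= 1 + k by plra.
by rewrite (ger0_norm k1') -mulrA ler_wpM2l.
Qed.

(** Leaving the right half-plane would start an alternation, hence happen at P, whose preimage Q is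
    on the left. So the orbit stays right and bounded; [ep], multiplied by [- k] at each step, must
    vanish, and [transient_right] excludes [mu < 0]. *)
Lemma nontransient_right_right z : NT z -> 0 <= z.1 -> 0 <= (L z).1 -> z = ptX.
Proof.
move=> ntz z0 Lz0.
have stay n : 0 <= (iter n L z).1 /\ 0 <= (iter n.+1 L z).1.
  elim: n => [//|n [IH1 IH2]]; split=> //; rewrite leNgt; apply/negP => neg.
  have a1 : alt (iter n.+1 L z).
    apply: alt_triangle => //; last exact: ltW.
      by rewrite /= mulr_ge0// ltW.
    exact/nontransient_mu_le0/nontransient_iter.
  have := nontransient_alternating (nontransient_iter ntz) a1.
  rewrite iterS -lozi_Q => /(can_inj LK) E.
  by have := Q1_lt0; rewrite -E ltNge IH1.
have Rb n : [/\ 0 <= (iter n L (L z)).1, 0 <= (iter n L (L z)).2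
    & mu (iter n L (L z)) <= 0].
  split; rewrite -iterSr; first exact: (stay n.+1).1.
    by rewrite iterS /= mulr_ge0 ?(ltW b0)//; exact: (stay n).1.
  exact/nontransient_mu_le0/nontransient_iter.
have ep0 : ep (L z) = 0.
  have [B HB] := norm_ep_bounded.
  apply: (@geometric_eq0 _ k^-1 B) => [|n].
    by rewrite invr_ge0 (ltW k0) invf_lt1.
  rewrite exprVn [leRHS]mulrC ler_pdivlMr ?exprn_gt0//.
  have -> : `|ep (L z)| * k ^+ n = `|ep (iter n L (L z))|.
    elim: n => [|n IH]; first by rewrite mulr1.
    rewrite iterS [in RHS]ep_right; last by have [] := Rb n.
    by rewrite normrM normrN (gtr0_norm k0) -IH exprS mulrCA.
  by have [? ? ?] := Rb n; exact: HB.
have pos n : 0 < (iter n L (L z)).1.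
  have en : ep (iter n L (L z)) = 0.
    elim: n => [//|n IH]; rewrite iterS ep_right ?IH ?mulr0//.
    by have [] := Rb n.
  by have [_ y0 _] := Rb n; move: en y0; rewrite /ep; pnra.
have m0 : mu (L z) = 0.
  apply/eqP; apply: contrapT => /negP mN; apply: (nontransient_lozi ntz).
  apply: transient_right (pos 0) (pos 1) _.
  by rewrite lt_neqAle mN; have [_ _ ->] := Rb 0.
by apply: (can_inj LK); rewrite L_ptX; exact: mu_ep_eq0.
Qed.

(** Away from X, [nontransient_right_right] sends each guarded point to the left, so [guard_F]
    applies again two steps later. *)
Lemma nontransient_guard_alternating z : NT z -> z <> ptX -> guard (lift z) -> alt z.
Proof.
have step w : NT w -> w <> ptX -> guard (lift w) ->
    [/\ 0 <= w.1, (L w).1 <= 0 & guard (lift (L (L w)))].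
  move=> ntw wX gw; have [w0 _ _] := guard_below gw.
  have Lw0 : (L w).1 <= 0.
    by rewrite leNgt; apply/negP => /ltW Lw0; apply/wX/nontransient_right_right.
  by split=> //; rewrite lozi2_lift//; apply: guard_F => //; rewrite -phi_lift.
move=> ntz zX gz.
have G n : iter n.*2 L z <> ptX /\ guard (lift (iter n.*2 L z)).
  elim: n => [//|n [IH1 IH2]]; have [_ _ ?] := step _ (nontransient_iter ntz) IH1 IH2.
  rewrite doubleS !iterS; split=> //; apply: contra_not IH1 => E.
  by do 2 apply: (can_inj LK); rewrite E !L_ptX.
move=> n; have [nX gn] := G n.
by have [? ? _] := step _ (nontransient_iter ntz) nX gn; split.
Qed.

(** Otherwise [L (L z)] lies in the triangle of [guard_triangle], hence is X or P; then [z] is that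
    same point, which is on the right. *)
Lemma nontransient_left_left z : NT z -> z.1 <= 0 -> (L z).1 <= 0 -> (L (L z)).1 <= 0.
Proof.
move=> ntz z0 Lz0; rewrite leNgt; apply/negP => LLz0.
have LLX : L (L z) <> ptX.
  move=> LLz; have /(can_inj LK) /(can_inj LK) E : L (L z) = L (L ptX).
    by rewrite !L_ptX.
  by have := ptX_gt0; rewrite -E ltNge z0.
have LLP : L (L z) <> P.
  move=> LLz; have /(can_inj LK) /(can_inj LK) E : L (L z) = L (L P).
    by rewrite lozi_P lozi_Q.
  by have := P1_gt0; rewrite -E ltNge z0.
apply: LLP; apply: nontransient_alternating; first by do 2 apply: nontransient_lozi.
apply: nontransient_guard_alternating => //; first by do 2 apply: nontransient_lozi.
apply: guard_triangle; first exact: ltW.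
  by rewrite /= mulr_ge0_le0// ltW.
rewrite (lozi_left Lz0) (lozi_left z0) /= -subr_ge0.
have -> : b + a * (b * (1 + z.2 + a * z.1)) -
  b * (1 + b * z.1 + a * (1 + z.2 + a * z.1)) = b ^+ 2 * - z.1 by ring.
by rewrite mulr_ge0 ?sqr_ge0// oppr_ge0.
Qed.

(** The lines [mu = 0] and [ga = 0], of slopes [- l] and [- k], bound a triangle with the y-axis. *)
Lemma nontransient_left_bounded : exists B, forall z, NT z -> z.1 <= 0 ->
  `|z.1| <= B /\ `|z.2| <= B.
Proof.
have l1' : 0 < 1 - l by plra.
have k1' : 0 < k - 1 by plra.
pose i := (1 - l)^-1 * l; pose j := (k - 1)^-1 * k.
have i0 : 0 <= i by rewrite mulr_ge0 ?invr_ge0 ?ltW.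
have j0 : 0 <= j by rewrite mulr_ge0 ?invr_ge0 ?ltW.
pose M := (i + j) / a.
have M0 : 0 <= M by rewrite divr_ge0 ?(ltW a0)// addr_ge0.
exists (M + i + j) => -[x y] ntz /= x0.
have hi : y + l * x <= i.
  rewrite /i [leRHS]mulrC ler_pdivlMr//.
  by have := nontransient_mu_le0 ntz; rewrite /mu /=; lra.
have hj : - j <= y + k * x.
  rewrite lerNl /j [leRHS]mulrC ler_pdivlMr//.
  by have := nontransient_ga_ge0 ntz; rewrite /ga /=; lra.
have hx : - x <= M by rewrite /M ler_pdivlMr//; move: hi hj; lra.
have hlx : l * - x <= M.
  by rewrite (le_trans _ hx)// ler_piMl ?oppr_ge0// ltW.
have hkx : 0 <= k * - x by rewrite mulr_ge0 ?oppr_ge0// ltW.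
rewrite !ler_norml; split; apply/andP; split.
all: by move: hi hj hx hlx hkx i0 j0 M0 x0; lra.
Qed.

(** Backwards the orbit alternates: a right predecessor would be X, and two left ones contradict
    [nontransient_left_left]. Its left points are bounded, which bounds [qP], and backward
    contraction gives P. *)
Lemma nontransient_right_left w : NT w -> 0 < w.1 -> (L w).1 <= 0 -> w = P.
Proof.
move=> ntw w0 Lw0.
have step z : NT z -> 0 < z.1 -> (L z).1 <= 0 ->
    [/\ (Li z).1 <= 0, 0 < (Li (Li z)).1 & (L (Li (Li z))).1 <= 0].
  move=> ntz z0 Lz0.
  have Liz0 : (Li z).1 < 0.
    rewrite ltNge; apply/negP => Liz0.
    have : Li z = ptX.
      apply: nontransient_right_right => //; last by rewrite LiK ltW.
      exact: nontransient_lozi_inv.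
    move=> /(congr1 L); rewrite LiK L_ptX => zX.
    by have := ptX_gt0; rewrite -L_ptX -zX ltNge Lz0.
  split; rewrite ?LiK ?ltW// ltNge; apply/negP => LLiz0.
  have nt2 := nontransient_lozi_inv (nontransient_lozi_inv ntz).
  have := nontransient_left_left nt2 LLiz0; rewrite !LiK.
  by move=> /(_ (ltW Liz0)); rewrite leNgt z0.
have all n : 0 < (iter n.*2 Li w).1 /\ (L (iter n.*2 Li w)).1 <= 0.
  elim: n => [//|n [IH1 IH2]]; rewrite doubleS !iterS.
  by have [_ ? ?] := step _ (nontransient_iter_inv ntw) IH1 IH2.
have [B HB] := nontransient_left_bounded.
have [C HC] := qQ_bounded a0 b0 kl1 ab1 ab2 B.
apply: (@ptP_alternating_backward _ a b _ _ _ _ _ w (fun n => iter n.*2 Li w) C) => //.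
- by move=> n; rewrite doubleS !iterS !LiK.
- by move=> n; have [? ?] := all n; rewrite ltW.
- move=> n; have [w1 w2] := all n; have ntn := nontransient_iter_inv (n := n.*2) ntw.
  have [Li0 _ _] := step _ ntn w1 w2.
  have [h1 h2] := HB _ (nontransient_lozi_inv ntn) Li0.
  have : qP a b (L (Li (iter n.*2 Li w))) <= qQ a b (Li (iter n.*2 Li w)).
    exact: qP_L_le.
  by rewrite LiK => /le_trans; apply; exact: HC.
Qed.

(** A past visit strictly to the right occurs at X or P and determines [z]. Otherwise the whole
    orbit stays left, and boundedness makes [ga] vanish forwards and [et] vanish backwards. *)
Lemma nontransient_classification z : NT z -> [\/ z = ptX, z = ptY, z = P | z = Q].
Proof.
move=> ntz.
have posE w : NT w -> 0 < w.1 -> w = ptX \/ w = P.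
  move=> ntw w0; have [Lw0|Lw0] := leP 0 (L w).1.
    by left; apply: nontransient_right_right => //; exact: ltW.
  by right; apply: nontransient_right_left => //; exact: ltW.
have [[n wn]|noR] := pselect (exists n, 0 < (iter n Li z).1).
  have zE : z = iter n L (iter n Li z).
    by elim: n {wn} => [//|n IH]; rewrite iterSr iterS LiK.
  have [wX|wP]   := posE _ (nontransient_iter_inv ntz) wn.
    by constructor 1; rewrite zE wX; elim: n {wn zE wX} => //= n ->; exact: L_ptX.
  have : iter n L P = P \/ iter n L P = Q.
    elim: n {wn zE wP} => [|n [|] E]; rewrite ?iterS ?E; [by left| |].
      by right; exact: lozi_P.
    by left; exact: lozi_Q.
  by rewrite -wP -zE => -[]; [constructor 3|constructor 4].
have back n : (iter n Li z).1 <= 0.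
  by rewrite leNgt; apply/negP => zn; apply: noR; exists n.
have forth n : (iter n L z).1 <= 0 /\ (iter n.+1 L z).1 <= 0.
  elim: n => [|n [IH1 IH2]]; last first.
    split=> //; rewrite !iterS.
    by apply: nontransient_left_left => //; exact: nontransient_iter.
  split; first exact: (back 0).
  have := nontransient_left_left (nontransient_lozi_inv ntz) (back 1).
  by rewrite LiK; apply; exact: (back 0).
have [B HB] := nontransient_left_bounded.
constructor 2; apply: ga_et_eq0.
  apply: (@geometric_eq0 _ k^-1 ((k - 1) * (k * B + B) + k)) => [|n].
    by rewrite invr_ge0 (ltW k0) invf_lt1.
  rewrite exprVn [leRHS]mulrC ler_pdivlMr ?exprn_gt0//.
  have -> : `|ga z| * k ^+ n = `|ga (iter n L z)|.
    elim: n => [|n IH]; first by rewrite mulr1.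
    rewrite iterS ga_left; last exact: (forth n).1.
    by rewrite normrM (gtr0_norm k0) -IH exprS mulrCA.
  have [h1 h2] := HB _ (nontransient_iter (n := n) ntz) (forth n).1.
  rewrite (le_trans (ler_normD _ _))// (gtr0_norm k0) lerD2r normrM.
  have k1' : 0 <= k - 1 by plra.
  rewrite (ger0_norm k1') ler_wpM2l// (le_trans (ler_normD _ _))//.
  by rewrite lerD// normrM (gtr0_norm k0) ler_wpM2l// ltW.
apply: (@geometric_eq0 _ l ((1 + l) * (B + l * B) + l)) => [|n].
  by rewrite (ltW l0).
have -> : `|et z| = l ^+ n * `|et (iter n Li z)|.
  elim: n => [|n IH]; first by rewrite mul1r.
  rewrite IH -{1}[iter n Li z]LiK -iterS et_left ?back//.
  by rewrite normrM normrN (gtr0_norm l0) exprSr -mulrA.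
rewrite ler_wpM2l ?exprn_ge0 ?(ltW l0)//.
have [h1 h2] := HB _ (nontransient_iter_inv (n := n) ntz) (back n).
rewrite (le_trans (ler_normD _ _))// (gtr0_norm l0) lerD2r normrM.
have l1' : 0 <= 1 + l by plra.
rewrite (ger0_norm l1') ler_wpM2l// (le_trans (ler_normB _ _))//.
by rewrite lerD// normrM (gtr0_norm l0) ler_wpM2l// ltW.
Qed.

End Eigencoordinates.

(** * Passage to the compactified plane and return to the parameters [a], [b] *)

Lemma zero_entropy_of_classification (R : realType) (a b : R) (s : {fset R * R}) :
  b != 0 -> (forall p, p \in s -> lozi a b p \in s) ->
  (forall z, z \notin s -> transient (lozi a b) z) -> lozi_entropy a b = 0%E.
Proof.
move=> b0 sL strans.
apply: (@topological_entropy_eq0 _ (one_point_compactification (R * R)%type) _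
  (None |` [fset Some p | p in s])%fset).
- exact: one_point_compactification_compact.
- apply: one_point_compactification_hausdorff; first exact: plane_locally_compact.
  exact: norm_hausdorff.
- apply: (@compactify_map_continuous _ _ (lozi_inv a b)).
  + exact: lozi_continuous.
  + exact: lozi_inv_continuous.
  + exact: loziK.
  + exact: lozi_invK.
- move=> p; rewrite !in_fsetE => /predU1P[->|/imfsetP[/= z zs ->]]; first by rewrite eqxx.
  by apply/orP; right; apply/imfsetP; exists (lozi a b z) => //; exact: sL.
- case=> [z|]; rewrite !in_fsetE //= => zs.
  apply: transient_compactify_map; apply: strans; apply: contra zs => zs.
  by apply/imfsetP; exists z.
Qed.

Theorem theorem1p1 (R : realType) (a b : R) (hab : lozi_region (a, b)) :
  lozi_entropy a b = 0%E.
Proof.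
case: hab => /andP[b0 b1] /andP[ab1 ab2] HZ.
(* [k] and [- l] are the roots of [t^2 - a t - b]. *)
pose s := Num.sqrt (a ^+ 2 + 4 * b); pose k := (a + s) / 2; pose l := k - a.
have a0 : 0 < a by lra.
have s0 : 0 <= s by exact: sqrtr_ge0.
have s2 : s ^+ 2 = a ^+ 2 + 4 * b by rewrite sqr_sqrtr// addr_ge0 ?sqr_ge0//; lra.
have kE : k = (a + s) / 2 by [].
have aE : a = k - l by rewrite /l; ring.
have bE : b = k * l.
  have -> : k * l = (s ^+ 2 - a ^+ 2) / 4 by rewrite /l kE; field.
  by rewrite s2; field.
have k1 : 1 < k by rewrite kE; nra.
have l0 : 0 < l by nra.
have l1 : l < 1 by nra.
have kl1 : k * l < 1 by rewrite -bE.
have kl : k * (1 - l) < 1 + l by lra.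
have ZE : loziZ a b = ((1 - l)^-1, 0).
  rewrite /loziZ -/s; congr (_, _).
  have -> : s = 2 * k - a by rewrite kE; field.
  have -> : 1 + a - b = (1 + k) * (1 - l) by rewrite bE {1}aE; ring.
  by field; rewrite !gt_eqF//; lra.
have altZ : alt k l ((1 - l)^-1, 0).
  rewrite -ZE /alt -aE -bE => n; split.
    have [_] := HZ n; have -> : (2 * n%:Z)%R = (n.*2)%:Z by rewrite -mul2n PoszM.
    by [].
  (* The odd time [2n + 1] is [2k - 1] for [k = n + 1]. *)
  have [+ _] := HZ n.+1.
  have -> : (2 * n.+1%:Z - 1)%R = (n.*2.+1)%:Z :> int.
    rewrite -[n.*2.+1]addn1 -[n.+1]addn1 -mul2n.
    by rewrite (PoszD n) (PoszD (2 * n)) PoszM; ring.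
  by [].
have bN0 : b != 0 by rewrite gt_eqF.
have LX : lozi a b (ptX k l) = ptX k l.
  by rewrite [X in lozi X]aE bE L_ptX.
have LY : lozi a b (ptY k l) = ptY k l.
  by rewrite [X in lozi X]aE bE L_ptY.
apply: (zero_entropy_of_classification
  (s := [fset ptX k l; ptY k l; ptP a b; ptQ a b]%fset)) => // [p|z zs].
  rewrite !in_fsetE -!orbA => /or4P[] /eqP ->.
  - by rewrite LX eqxx.
  - by rewrite LY eqxx orbT.
  - by rewrite L_ptP// eqxx !orbT.
  - by rewrite L_ptQ// eqxx !orbT.
apply: contrapT => ntz; move: zs; rewrite !in_fsetE !negb_or.
have := @nontransient_classification _ k l l0 l1 k1 kl1 kl altZ z.
rewrite -aE -bE => /(_ ntz)[] ->; rewrite eqxx ?andbF//.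
Qed.
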